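(* Let $d\ge1$, $\beta\ge0$, $\gamma\in(\frac13,1]$, $\sigma>\frac d2$, $z>0$ and $t\in\mathbb{R}$. Let $h(y)=\sum_{n\ge2}a_ny^n$ ($a_n\in\mathbb{R}$) be an analytic function with analyticity radius $R>0$, and consider a Gevrey source term $q\in\mathcal{B}_\varepsilon$ with $\varepsilon>0$, where $\mathcal{B}_r$ denotes the closed ball of Gevrey functions $\omega$ on $\mathbb{T}^d$ such that $\|A_z(\nabla_x,t\nabla_x)\omega\|_{L^2_x}\le r$. If $\varepsilon$ is sufficiently small, there exists $r(\varepsilon)$ such that $r(\varepsilon)=\mathcal{O}(\varepsilon)$ as $\varepsilon\to0$ and so that the equation $$\varrho(x)=q(x)-h\big((\beta-\Delta)^{-1}\varrho\big)(x),\qquad x\in\mathbb{T}^d,$$ admits a unique Gevrey solution $\varrho\in\mathcal{B}_{r(\varepsilon)}$.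
   Context: $\mathbb{T}^d=\mathbb{R}^d/(2\pi\mathbb{Z})^d$; $\langle k,\eta\rangle=\sqrt{1+|k|^2+|\eta|^2}$; $\widehat\omega(k)=\int_{\mathbb{T}^d}\omega(x)e^{-ik\cdot x}dx$ for $k\in\mathbb{Z}^d$. The weight is $A_z(k,\eta)=e^{z\langle k,\eta\rangle^\gamma}\langle k,\eta\rangle^\sigma$, and $\|A_z(\nabla_x,t\nabla_x)\omega\|_{L^2_x}^2=\sum_{k\in\mathbb{Z}^d}A_z(k,kt)^2|\widehat\omega(k)|^2$. The operator $(\beta-\Delta)^{-1}$ acts on the Fourier side by $\widehat{(\beta-\Delta)^{-1}\omega}(k)=\frac{1}{\beta+|k|^2}\widehat\omega(k)$. The equation for $\varrho$ is the reformulation, in terms of the modified density $\varrho=(\beta-\Delta)u$, of the nonlinear elliptic equation $-\Delta u+\beta u+h(u)=q$.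
   Formalization: For β = 0 the multiplier 1/(β+|k|²) is undefined at k = 0; there it is taken to be 0, so (−Δ)^{-1} discards the mean of ϱ and returns the mean-zero solution. All β > 0 are as stated. *)

(* Defs.v *)
From HB Require Import structures.
From mathcomp Require Import all_boot all_order all_algebra.
From mathcomp Require Import complex.
From mathcomp Require Import all_classical all_reals all_analysis.
Set Implicit Arguments.
Unset Strict Implicit.
Unset Printing Implicit Defensive.
Import Order.TTheory GRing.Theory Num.Theory.
Import numFieldNormedType.Exports.
Local Open Scope classical_set_scope.
Local Open Scope complex_scope.
Local Open Scope ring_scope.

Definition freq (R : realType) d (k : 'rV[int]_d) : 'rV[R]_d := map_mx intr k.

Definition dotp (R : realType) d (x y : 'rV[R]_d) : R :=
  \sum_(i < d) x 0 i * y 0 i.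

(* Real-valued continuous functions on the torus (R / 2 pi Z)^d, represented as
   2 pi-periodic functions on R^d.  A function with finite Gevrey norm (z > 0)
   has an absolutely convergent Fourier series, hence is a.e. equal to exactly
   one such function. *)
Definition torus_function (R : realType) d (f : 'rV[R]_d -> R) : Prop :=
  continuous f /\
  forall (x : 'rV[R]_d) (k : 'rV[int]_d), f (x + (2 * pi) *: freq R k) = f x.

(* Integral over the fundamental domain [0, 2 pi]^d, as an iterated Lebesgue
   integral; it is only applied to continuous functions, for which it agrees
   with the integral against d-dimensional Lebesgue measure by Fubini. *)
Fixpoint torus_integral (R : realType) d : ('rV[R]_d -> R) -> R :=
  match d with
  | 0 => fun f => f 0
  | d'.+1 => fun f : 'rV[R]_(1 + d') -> R =>
      \int[lebesgue_measure]_(s in `[0, 2 * pi])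
        torus_integral (fun y : 'rV[R]_d' => f (row_mx (\row_(_ < 1) s) y))
  end.

(* The integral of f(x) e^{- i k . x} over the torus (with no factor
   (2 pi)^{-d}), split into real and imaginary parts, f being real-valued. *)
Definition fourier (R : realType) d (f : 'rV[R]_d -> R) (k : 'rV[int]_d) :
    R[i] :=
  torus_integral (fun x => f x * cos (dotp (freq R k) x))
  +i* (- torus_integral (fun x => f x * sin (dotp (freq R k) x))).

Definition japanese (R : realType) d (k eta : 'rV[R]_d) : R :=
  Num.sqrt (1 + dotp k k + dotp eta eta).

Definition weight (R : realType) (gamma sigma z : R) d (k eta : 'rV[R]_d) : R :=
  expR (z * japanese k eta `^ gamma) * japanese k eta `^ sigma.

(* The norm || A_z(nabla_x, t nabla_x) f ||_{L^2_x}, possibly +oo. *)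
Definition gevrey_norm (R : realType) (gamma sigma z t : R) d
    (f : 'rV[R]_d -> R) : \bar R :=
  ((\esum_(k in [set: 'rV[int]_d])
     (weight gamma sigma z (freq R k) (t *: freq R k) ^+ 2
       * Normc.normc (fourier f k) ^+ 2)%:E) `^ 2^-1)%E.

Definition gevrey_ball (R : realType) (gamma sigma z t : R) d (r : R) :
    set ('rV[R]_d -> R) :=
  [set f | torus_function f /\ (gevrey_norm gamma sigma z t f <= r%:E)%E].

(* u = (beta - Delta)^{-1} rho.  For beta = 0 the convention 0^-1 = 0 makes this
   the inverse of - Delta onto mean-zero functions: the zero mode of rho is
   discarded and u has mean zero. *)
Definition is_resolvent (R : realType) (beta : R) d
    (rho u : 'rV[R]_d -> R) : Prop :=
  torus_function u /\
  forall k : 'rV[int]_d,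
    fourier u k = ((beta + dotp (freq R k) (freq R k))^-1)%:C * fourier rho k.

(* Radius of convergence of \sum_n a_n y^n, possibly +oo. *)
Definition cvg_radius (R : realType) (a : R^nat) : \bar R :=
  ereal_sup [set `|y|%:E | y in [set y : R | cvgn (pseries a y)]].

Definition pseries_sum (R : realType) (a : R^nat) (y : R) : R :=
  limn (pseries a y).

(* rho = q - h ((beta - Delta)^{-1} rho) on the torus, for h(y) = \sum_n a_n y^n;
   the equation makes sense only when (beta - Delta)^{-1} rho takes its values
   inside the disc of convergence of h. *)
Definition is_solution (R : realType) (beta : R) (a : R^nat) d
    (q rho : 'rV[R]_d -> R) : Prop :=
  exists u : 'rV[R]_d -> R,
    is_resolvent beta rho u /\
    forall x : 'rV[R]_d,
      (`|u x|%:E < cvg_radius a)%E /\ rho x = q x - pseries_sum a (u x).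

(* Main.v *)
Require Import Defs.
From HB Require Import structures.
From mathcomp Require Import all_boot all_order all_algebra.
From mathcomp Require Import complex ring lra.
From mathcomp Require Import all_classical all_reals all_analysis.
Set Implicit Arguments.
Unset Strict Implicit.
Unset Printing Implicit Defensive.
Import Order.TTheory GRing.Theory Num.Theory.
Import numFieldNormedType.Exports.
Local Open Scope classical_set_scope.
Local Open Scope ring_scope.

(** The proof is a contraction argument in the Gevrey space, which is a Banach
    algebra of continuous functions.

    Let v be the square of the weight A_z(k, k t). Two properties of v matter.
    First, 1 / v is summable over the lattice, because the polynomial factor has
    exponent 2 sigma > d ([gevrey_weight_summable]). By Cauchy-Schwarz the
    Fourier series of a function in a Gevrey ball converges absolutely, and the
    uniform norm is dominated by the Gevrey norm ([wball_sup]). Second, the sum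
    over l of v k / (v l * v (k - l)) is bounded uniformly in k
    ([gevrey_weight_convolution]): subadditivity of the bracket and of the power
    gamma <= 1 makes the exponential factor submultiplicative, and the polynomial
    factor leaves a summable weight. By Cauchy-Schwarz for convolutions, the
    Gevrey norm is then submultiplicative up to a constant ([wball_mul]).

    The operator (beta - Delta)^-1 is a bounded Fourier multiplier, so
    u = (beta - Delta)^-1 rho lies in a ball of radius proportional to that of
    rho. Since h starts at degree 2, u -> h(u) is Lipschitz on a ball of radius r
    with a constant proportional to r ([wball_pseries_lipschitz]). Hence for eps
    small the map rho -> q - h((beta - Delta)^-1 rho) preserves the ball of
    radius 2 eps and halves distances there, whence existence by Picard iteration
    ([fixed_point_exists]) and uniqueness ([fixed_point_unique]), with
    r(eps) = 2 eps.

    The passage between functions and coefficients rests on the uniqueness of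
    Fourier coefficients of continuous functions on the torus
    ([torus_fourier_unique]). It is proved on the circle with powers of a
    trigonometric kernel that concentrate at a point ([circle_orthogonal_le0]),
    and then by induction on the dimension. It yields Fourier inversion
    ([fourier_inversion]), the product estimate by approximation with
    trigonometric polynomials, and the uniqueness of u for a given rho. *)

(** * Integration over the torus *)

Section TorusIntegral.
Context (R : realType).

Definition circle_integral (g : R -> R) : R :=
  \int[lebesgue_measure]_(s in `[0, 2 * pi]) g s.

Lemma twopi_gt0 : 0 < 2 * pi :> R.
Proof. by rewrite mulr_gt0 ?pi_gt0. Qed.

Lemma circle_integrable (g : R -> R) : continuous g ->
  lebesgue_measure.-integrable `[0, 2 * pi] (EFin \o g).
Proof.
move=> cg; apply: continuous_compact_integrable; first exact: segment_compact.
exact: continuous_subspaceT.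
Qed.

Lemma circle_integral_lin (a b : R) (f g : R -> R) :
  continuous f -> continuous g ->
  circle_integral (fun s => a * f s + b * g s) =
  a * circle_integral f + b * circle_integral g.
Proof.
move=> cf cg; rewrite /circle_integral -!RintegralZl //; last 2 first.
- exact: circle_integrable.
- exact: circle_integrable.
rewrite -RintegralD //; apply: circle_integrable => s;
  by apply: cvgM; [exact: cvg_cst|exact: cf || exact: cg].
Qed.

Lemma circle_integral_cst (c : R) : circle_integral (fun=> c) = c * (2 * pi).
Proof.
rewrite /circle_integral Rintegral_cst //= lebesgue_measure_itv /= lte_fin.
by rewrite twopi_gt0 /= oppr0 addr0.
Qed.

Lemma circle_integral_le (f g : R -> R) : continuous f -> continuous g ->
  (forall s, 0 <= s <= 2 * pi -> f s <= g s) ->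
  circle_integral f <= circle_integral g.
Proof.
move=> cf cg fg; apply: le_Rintegral => [//| | |s hs].
- exact: circle_integrable.
- exact: circle_integrable.
- by apply: fg; move: hs; rewrite /= in_itv.
Qed.

Lemma circle_integral_close (f g : R -> R) (e : R) :
  continuous f -> continuous g ->
  (forall s, 0 <= s <= 2 * pi -> `|f s - g s| <= e) ->
  `|circle_integral f - circle_integral g| <= (2 * pi) * e.
Proof.
move=> cf cg fg.
have -> : circle_integral f - circle_integral g =
    circle_integral (fun s => 1 * f s + (-1) * g s).
  by rewrite circle_integral_lin // mul1r mulN1r.
have ch : continuous (fun s => 1 * f s + (-1) * g s).
  move=> s; apply: cvgD; apply: cvgM; try exact: cvg_cst; [exact: cf|exact: cg].
have cc (c : R) : continuous (fun _ : R => c) by move=> s; exact: cvg_cst.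
rewrite ler_norml; apply/andP; split.
  rewrite -mulrN mulrC -circle_integral_cst; apply: circle_integral_le => // s hs.
  by have := fg s hs; rewrite ler_norml mul1r mulN1r => /andP[].
rewrite mulrC -circle_integral_cst; apply: circle_integral_le => // s hs.
by have := fg s hs; rewrite ler_norml mul1r mulN1r => /andP[].
Qed.

(** ** Slices of a function of several variables *)

(** Parallel to the recursive clause of [torus_integral], so that iterated
    integrals reduce to it by conversion. *)
Definition scons d (s : R) (y : 'rV[R]_d) : 'rV[R]_(1 + d) :=
  row_mx (\row_(_ < 1) s) y.

Lemma scons_ball d (s0 s : R) (y0 y : 'rV[R]_d) e : 0 < e ->
  ball s0 e s -> ball y0 e y -> ball (scons s0 y0) e (scons s y).
Proof.
move=> e0 hs [_ hy]; split => // i j; rewrite /scons.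
case: (splitP (j : 'I_(1 + d))) => [k jk|k jk].
  rewrite (_ : j = lshift d k); last exact: val_inj.
  by rewrite !row_mxEl !mxE.
rewrite (_ : j = rshift 1 k); last exact: val_inj.
by rewrite !row_mxEr.
Qed.

Lemma continuous_slice_l d (f : 'rV[R]_(1 + d) -> R) (s : R) :
  continuous f -> continuous (fun y : 'rV[R]_d => f (scons s y)).
Proof.
move=> cf y A /(cf (scons s y)) /nbhs_ballP[e /= e0 eA].
apply/nbhs_ballP; exists e => // y' hy.
by apply: eA; apply: scons_ball => //; exact: ballxx.
Qed.

Lemma continuous_slice_r d (f : 'rV[R]_(1 + d) -> R) (y : 'rV[R]_d) :
  continuous f -> continuous (fun s => f (scons s y)).
Proof.
move=> cf s A /(cf (scons s y)) /nbhs_ballP[e /= e0 eA].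
apply/nbhs_ballP; exists e => // s' hs.
by apply: eA; apply: scons_ball => //; exact: ballxx.
Qed.

Definition box d : set 'rV[R]_d := [set x | forall i, 0 <= x 0 i <= 2 * pi].

Lemma box_compact d : compact (@box d).
Proof.
rewrite (_ : @box d = [set x | forall i, `[0, 2 * pi]%classic (x ord0 i)]).
  by apply: (@rV_compact R d (fun=> `[0, 2 * pi]%classic)) => i; exact: segment_compact.
by apply/seteqP; split => x hx i; have := hx i; rewrite /= in_itv.
Qed.

Lemma box_scons d s (y : 'rV[R]_d) : 0 <= s <= 2 * pi -> box y ->
  box (scons s y).
Proof.
move=> hs hy j; rewrite /scons.
case: (splitP (j : 'I_(1 + d))) => [k jk|k jk].
  rewrite (_ : j = lshift d k); last exact: val_inj.
  by rewrite !row_mxEl !mxE.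
rewrite (_ : j = rshift 1 k); last exact: val_inj.
by rewrite !row_mxEr.
Qed.

(** Compactness of the box of the remaining variables makes continuity in the
    first variable uniform. *)
Lemma slice_uniform d (f : 'rV[R]_(1 + d) -> R) (s0 e : R) : continuous f ->
  0 < e -> \forall s \near s0,
    forall y, box y -> `|f (scons s y) - f (scons s0 y)| <= e.
Proof.
move=> cf e0.
have /compact_near_coveringP := @box_compact d.
move=> cK.
apply: (cK R (nbhs s0) (fun s y => `|f (scons s y) - f (scons s0 y)| <= e) _).
move=> y _.
have e20 : 0 < e / 2 by rewrite divr_gt0.
have /nbhs_ballP[del /= del0 hdel] := cf (scons s0 y) _ (nbhsx_ballx _ _ e20).
exists (ball y del, ball s0 del).
  by split; apply/nbhs_ballP; exists del.
move=> [y' s] /= [hy hs].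
have h1 : ball (f (scons s0 y)) (e / 2) (f (scons s y')).
  by apply: hdel; exact: scons_ball.
have h2 : ball (f (scons s0 y)) (e / 2) (f (scons s0 y')).
  by apply: hdel; apply: scons_ball => //; exact: ballxx.
move: h1 h2; rewrite /ball /= => h1 h2.
have -> : f (scons s y') - f (scons s0 y') =
  (f (scons s0 y) - f (scons s0 y')) - (f (scons s0 y) - f (scons s y')) by lra.
by apply: (le_trans (ler_normB _ _)); lra.
Qed.

(** The two halves feed each other: comparing outer integrals requires the
    inner ones to be continuous, hence integrable, in the outer variable, and
    that continuity is the comparison of integrals of nearby slices. *)
Lemma torus_integral_close_cont d :
  (forall (f g : 'rV[R]_d -> R) e, continuous f -> continuous g ->
    (forall x, box x -> `|f x - g x| <= e) ->
    `|torus_integral f - torus_integral g| <= (2 * pi) ^+ d * e) /\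
  (forall f : 'rV[R]_(1 + d) -> R, continuous f ->
    continuous (fun s => torus_integral (fun y : 'rV[R]_d => f (scons s y)))).
Proof.
elim: d => [|d [IH1 IH2]].
  split=> [f g e _ _ fg|f cf]; first by rewrite expr0 mul1r; apply: fg => -[].
  by move=> s /=; exact: continuous_slice_r.
have H1 (f g : 'rV[R]_d.+1 -> R) e : continuous f -> continuous g ->
    (forall x, box x -> `|f x - g x| <= e) ->
    `|torus_integral f - torus_integral g| <= (2 * pi) ^+ d.+1 * e.
  move=> cf cg fg /=; rewrite exprS -mulrA.
  apply: (@circle_integral_close _ _ ((2 * pi) ^+ d * e)).
  - exact: (IH2 f).
  - exact: (IH2 g).
  - move=> s hs; apply: IH1.
    + exact: (@continuous_slice_l d).
    + exact: (@continuous_slice_l d).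
    + by move=> y hy; apply: fg; exact: box_scons.
split=> [|f cf s0]; first exact: H1.
apply/cvgrPdist_le => e e0.
pose P : R := (2 * pi) ^+ d.+1.
have P0 : 0 < P by rewrite exprn_gt0 // twopi_gt0.
near=> s; apply: (@le_trans _ _ (P * (e / P))); last by rewrite mulrC divfK ?gt_eqF.
apply: H1; try exact: (@continuous_slice_l d.+1).
move=> y hy; rewrite distrC.
move: y hy; near: s; apply: slice_uniform => //.
by rewrite divr_gt0.
Unshelve. all: by end_near.
Qed.

Lemma torus_integral_close d (f g : 'rV[R]_d -> R) e :
  continuous f -> continuous g ->
  (forall x, box x -> `|f x - g x| <= e) ->
  `|torus_integral f - torus_integral g| <= (2 * pi) ^+ d * e.
Proof. exact: (torus_integral_close_cont d).1. Qed.

Lemma continuous_inner_integral d (f : 'rV[R]_(1 + d) -> R) : continuous f ->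
  continuous (fun s => torus_integral (fun y : 'rV[R]_d => f (scons s y))).
Proof. exact: (torus_integral_close_cont d).2. Qed.

Lemma torus_integral_lin d (a b : R) (f g : 'rV[R]_d -> R) :
  continuous f -> continuous g ->
  torus_integral (fun x => a * f x + b * g x) =
  a * torus_integral f + b * torus_integral g.
Proof.
elim: d f g => [//|d IH] f g cf cg /=.
rewrite -[RHS](@circle_integral_lin a b
  (fun s => torus_integral (fun y : 'rV[R]_d => f (scons s y)))
  (fun s => torus_integral (fun y : 'rV[R]_d => g (scons s y)))).
- congr Rintegral; apply/funext => s; apply: IH; exact: (@continuous_slice_l d).
- exact: continuous_inner_integral.
- exact: continuous_inner_integral.
Qed.

Lemma continuous_lin (T : topologicalType) (a b : R) (f g : T -> R) :
  continuous f -> continuous g -> continuous (fun x => a * f x + b * g x).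
Proof.
by move=> cf cg x; apply: cvgD; apply: cvgM; try exact: cvg_cst; [exact: cf|exact: cg].
Qed.

Lemma torus_integral_cst d (c : R) :
  torus_integral (fun _ : 'rV[R]_d => c) = (2 * pi) ^+ d * c.
Proof.
elim: d => [|d IH] /=; first by rewrite mul1r.
transitivity (circle_integral (fun=> (2 * pi) ^+ d * c)).
  by congr Rintegral; apply/funext.
by rewrite circle_integral_cst exprS; ring.
Qed.

Lemma torus_integralZ d (a : R) (f : 'rV[R]_d -> R) : continuous f ->
  torus_integral (fun x => a * f x) = a * torus_integral f.
Proof.
move=> cf; have := torus_integral_lin a 0 cf cf.
by rewrite mul0r addr0 => <-; congr torus_integral; apply/funext => x; rewrite mul0r addr0.
Qed.

Lemma torus_integralD d (f g : 'rV[R]_d -> R) : continuous f -> continuous g ->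
  torus_integral (fun x => f x + g x) = torus_integral f + torus_integral g.
Proof.
move=> cf cg; have := torus_integral_lin 1 1 cf cg.
by rewrite !mul1r => <-; congr torus_integral; apply/funext => x; rewrite !mul1r.
Qed.

Lemma continuous_sum (T : topologicalType) (I : Type) (s : seq I)
  (F : I -> T -> R) : (forall i, continuous (F i)) ->
  continuous (fun x => \sum_(i <- s) F i x).
Proof.
move=> cF; elim: s => [|i s IH].
  by under eq_fun do rewrite big_nil; move=> x; exact: cvg_cst.
under eq_fun do rewrite big_cons.
by move=> x; apply: cvgD; [exact: cF|exact: IH].
Qed.

Lemma torus_integral_sum d (I : Type) (s : seq I) (F : I -> 'rV[R]_d -> R) :
  (forall i, continuous (F i)) ->
  torus_integral (fun x => \sum_(i <- s) F i x) =
  \sum_(i <- s) torus_integral (F i).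
Proof.
move=> cF; elim: s => [|i s IH].
  rewrite big_nil; under eq_fun do rewrite big_nil.
  by rewrite torus_integral_cst mulr0.
rewrite big_cons -IH -torus_integralD //; last exact: continuous_sum.
by congr torus_integral; apply/funext => x; rewrite big_cons.
Qed.

End TorusIntegral.

(** * Uniqueness of Fourier coefficients on the circle *)

Section Circle.
Context (R : realType).
Implicit Types (F f : R -> R) (n : int).

Lemma circle_FTC F f : continuous f -> (forall s : R, is_derive s 1 F (f s)) ->
  circle_integral f = F (2 * pi) - F 0.
Proof.
move=> cf dF.
have cF : continuous F.
  by move=> s; apply: differentiable_continuous; apply/derivable1_diffP; apply: ex_derive.
rewrite /circle_integral /Rintegral (@continuous_FTC2 R f F) //.
- exact: twopi_gt0.
- exact: continuous_subspaceT.
- split=> [s _||]; first exact: ex_derive.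
  + by apply: cvg_at_right_filter; exact: cF.
  + by apply: cvg_at_left_filter; exact: cF.
- by move=> s _; rewrite derive1E; apply: derive_val.
Qed.

Lemma trig_int_shift n (x : R) :
  cos (x + n%:~R * (2 * pi)) = cos x /\ sin (x + n%:~R * (2 * pi)) = sin x.
Proof.
have tp : 2 * pi = pi *+ 2 :> R by rewrite mulr_natl.
have H (m : nat) (y : R) :
    cos (y + m%:R * (2 * pi)) = cos y /\ sin (y + m%:R * (2 * pi)) = sin y.
  by rewrite tp mulr_natl (periodicn (@cosD2pi R)) (periodicn (@sinD2pi R)).
case: n => m; first by rewrite -pmulrn; exact: H.
rewrite NegzE mulrNz mulNr -pmulrn.
by have [<- <-] := H m.+1 (x - m.+1%:R * (2 * pi)); rewrite subrK.
Qed.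

Lemma trig_int n : cos (n%:~R * (2 * pi)) = 1 :> R /\
  sin (n%:~R * (2 * pi)) = 0 :> R.
Proof. by have := trig_int_shift n 0; rewrite add0r cos0 sin0. Qed.

Lemma continuous_cosn n : continuous (fun s : R => cos (n%:~R * s)).
Proof.
move=> s; apply: continuous_comp; last exact: continuous_cos.
by apply: cvgM; [exact: cvg_cst|exact: cvg_id].
Qed.

Lemma continuous_sinn n : continuous (fun s : R => sin (n%:~R * s)).
Proof.
move=> s; apply: continuous_comp; last exact: continuous_sin.
by apply: cvgM; [exact: cvg_cst|exact: cvg_id].
Qed.

Lemma circle_integral_cos n :
  circle_integral (fun s : R => cos (n%:~R * s)) = (n == 0)%:R * (2 * pi).
Proof.
have [->|n0] := eqVneq n 0.
  rewrite mul1r -[RHS]mul1r -circle_integral_cst; congr circle_integral.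
  by apply/funext => s; rewrite mul0r cos0.
have a0 : n%:~R != 0 :> R by rewrite intr_eq0.
rewrite mul0r.
have dF (s : R) : is_derive s 1 (fun s : R => (n%:~R)^-1 * sin (n%:~R * s))
    (cos (n%:~R * s)).
  by apply: is_derive_eq; rewrite /GRing.scale /= mulr1; field.
rewrite (circle_FTC _ dF) ?(trig_int n).2 ?mulr0 ?sin0 ?mulr0 ?subrr //.
exact: continuous_cosn.
Qed.

Lemma circle_integral_sin n : circle_integral (fun s : R => sin (n%:~R * s)) = 0.
Proof.
have [->|n0] := eqVneq n 0.
  rewrite -[RHS](mul0r (2 * pi)) -circle_integral_cst; congr circle_integral.
  by apply/funext => s; rewrite mul0r sin0.
have a0 : n%:~R != 0 :> R by rewrite intr_eq0.
have dF (s : R) : is_derive s 1 (fun s : R => - (n%:~R)^-1 * cos (n%:~R * s))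
    (sin (n%:~R * s)).
  by apply: is_derive_eq; rewrite /GRing.scale /= mulr1; field.
rewrite (circle_FTC _ dF) ?(trig_int n).1 ?mulr0 ?cos0 ?subrr //.
exact: continuous_sinn.
Qed.

Definition circle_orthogonal F := forall n,
  circle_integral (fun s => F s * cos (n%:~R * s)) = 0 /\
  circle_integral (fun s => F s * sin (n%:~R * s)) = 0.

Lemma continuous_mul (T : topologicalType) (f g : T -> R) :
  continuous f -> continuous g -> continuous (fun x => f x * g x).
Proof. by move=> cf cg x; apply: cvgM; [exact: cf|exact: cg]. Qed.

Lemma circle_orthogonal_lin (a b : R) F G : continuous F -> continuous G ->
  circle_orthogonal F -> circle_orthogonal G ->
  circle_orthogonal (fun s => a * F s + b * G s).
Proof.
move=> cF cG oF oG n; split.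
- under eq_fun do rewrite mulrDl -!mulrA.
  rewrite circle_integral_lin ?(oF n).1 ?(oG n).1 ?mulr0 ?addr0 //;
    by apply: continuous_mul => //; exact: continuous_cosn.
- under eq_fun do rewrite mulrDl -!mulrA.
  rewrite circle_integral_lin ?(oF n).2 ?(oG n).2 ?mulr0 ?addr0 //;
    by apply: continuous_mul => //; exact: continuous_sinn.
Qed.

Lemma circle_orthogonal_cos F : continuous F -> circle_orthogonal F ->
  circle_orthogonal (fun s => F s * cos s).
Proof.
move=> cF oF n.
have e1 (s : R) : (n + 1)%:~R * s = n%:~R * s + s by rewrite intrD mulrDl mul1r.
have e2 (s : R) : (n - 1)%:~R * s = n%:~R * s - s by rewrite intrB mulrBl mul1r.
split.
- rewrite (_ : (fun s => _) = (fun s => 2^-1 * (F s * cos ((n + 1)%:~R * s)) +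
                                 2^-1 * (F s * cos ((n - 1)%:~R * s)))).
    rewrite circle_integral_lin ?(oF _).1 ?mulr0 ?addr0 //;
      by apply: continuous_mul => //; exact: continuous_cosn.
  by apply/funext => s; rewrite e1 e2 cosD cosB; field.
- rewrite (_ : (fun s => _) = (fun s => 2^-1 * (F s * sin ((n + 1)%:~R * s)) +
                                 2^-1 * (F s * sin ((n - 1)%:~R * s)))).
    rewrite circle_integral_lin ?(oF _).2 ?mulr0 ?addr0 //;
      by apply: continuous_mul => //; exact: continuous_sinn.
  by apply/funext => s; rewrite e1 e2 sinD sinB; field.
Qed.

Lemma circle_orthogonal_sin F : continuous F -> circle_orthogonal F ->
  circle_orthogonal (fun s => F s * sin s).
Proof.
move=> cF oF n.
have e1 (s : R) : (n + 1)%:~R * s = n%:~R * s + s by rewrite intrD mulrDl mul1r.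
have e2 (s : R) : (n - 1)%:~R * s = n%:~R * s - s by rewrite intrB mulrBl mul1r.
split.
- rewrite (_ : (fun s => _) = (fun s => 2^-1 * (F s * sin ((n + 1)%:~R * s)) +
                                 (- 2^-1) * (F s * sin ((n - 1)%:~R * s)))).
    rewrite circle_integral_lin ?(oF _).2 ?mulr0 ?addr0 //;
      by apply: continuous_mul => //; exact: continuous_sinn.
  by apply/funext => s; rewrite e1 e2 sinD sinB; field.
- rewrite (_ : (fun s => _) = (fun s => 2^-1 * (F s * cos ((n - 1)%:~R * s)) +
                                 (- 2^-1) * (F s * cos ((n + 1)%:~R * s)))).
    rewrite circle_integral_lin ?(oF _).1 ?mulr0 ?addr0 //;
      by apply: continuous_mul => //; exact: continuous_cosn.
  by apply/funext => s; rewrite e1 e2 cosB cosD; field.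
Qed.

(** Orthogonality to all waves survives multiplication by a wave, by the
    product-to-sum formulas, hence by any trigonometric polynomial. *)
Lemma circle_orthogonal_kernel F (s0 c : R) (m : nat) :
  continuous F -> circle_orthogonal F ->
  continuous (fun s => F s * (c + cos (s - s0)) ^+ m) /\
  circle_orthogonal (fun s => F s * (c + cos (s - s0)) ^+ m).
Proof.
move=> cF oF; elim: m => [|m [IH1 IH2]].
  by rewrite (_ : (fun s => _) = F) //; apply/funext => s; rewrite expr0 mulr1.
set G := (fun s => _) in IH1 IH2 *.
have cC : continuous (fun s => G s * cos s).
  by apply: continuous_mul => //; exact: continuous_cos.
have cS : continuous (fun s => G s * sin s).
  by apply: continuous_mul => //; exact: continuous_sin.
rewrite (_ : (fun s => _) = (fun s => c * G s + 1 * (cos s0 * (G s * cos s) +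
  sin s0 * (G s * sin s)))); last first.
  by apply/funext => s; rewrite /G exprS cosB; ring.
split; first by apply: continuous_lin => //; exact: continuous_lin.
apply: circle_orthogonal_lin => //; first exact: continuous_lin.
apply: circle_orthogonal_lin => //.
- exact: circle_orthogonal_cos.
- exact: circle_orthogonal_sin.
Qed.

End Circle.

Section CircleUnique.
Context (R : realType).
Implicit Types (F f : R -> R).

Lemma cos_decr (x y : R) : 0 <= x -> x <= y -> y <= pi -> cos y <= cos x.
Proof.
move=> x0 xy yp.
rewrite le_eqVlt in xy; case/orP: xy => [/eqP->//|xy].
by rewrite ltW // ltr_cos // in_itv /=; apply/andP; split; lra.
Qed.

Lemma cos_le_far (e x : R) : 0 <= e -> e <= x -> x <= 2 * pi - e ->
  cos x <= cos e.
Proof.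
move=> e0 ex xe; case: (leP x pi) => xp; first exact: cos_decr.
have -> : cos x = cos (2 * pi - x).
  by rewrite -cosN -(cosD2pi (- x)) -[pi *+ 2]mulr_natl addrC.
by apply: cos_decr => //; lra.
Qed.

(** If F were positive at s0, its product with a high power of a kernel
    1 - cos e + cos (s - s0) would have a large integral: the kernel exceeds 1
    near s0 and is bounded by 1 in absolute value elsewhere. *)
Lemma circle_orthogonal_le0 F (s0 : R) : continuous F -> circle_orthogonal F ->
  0 < s0 < 2 * pi -> F s0 <= 0.
Proof.
move=> cF oF /andP[s0g s0l]; rewrite leNgt; apply/negP => Fs0.
(* F >= c on the interval of radius e around s0, which stays inside the period. *)
pose c := F s0 / 2; have c0 : 0 < c by rewrite divr_gt0.
have /nbhs_ballP[del /= del0 hdel] := cF s0 _ (nbhsx_ballx _ _ c0).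
have [e [e0 edel es0 e2p]] : exists e : R, [/\ 0 < e, e < del, e <= s0 & e <= 2 * pi - s0].
  exists (Num.min (del / 2) (Num.min s0 (2 * pi - s0))).
  rewrite !lt_min !gt_min !ge_min !lexx ?orbT s0g subr_gt0 s0l divr_gt0 //=.
  by rewrite (_ : del / 2 < del) //; lra.
have Fc (s : R) : `|s - s0| <= e -> c <= F s.
  move=> hs; have : ball (F s0) c (F s).
    by apply: hdel; rewrite /ball /= distrC; lra.
  by rewrite /ball /= ltr_norml /c => /andP[_]; lra.
have epi : e <= pi by lra.
pose Q (s : R) := (1 - cos e) + cos (s - s0).
pose q : R := 1 - cos e + cos (e / 2).
have q1 : 1 < q.
  have : cos e < cos (e / 2) by rewrite ltr_cos ?in_itv /=; [lra|apply/andP; split; lra..].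
  by rewrite /q; lra.
have Qin (s : R) : `|s - s0| <= e / 2 -> q <= Q s.
  move=> hs; rewrite /q /Q lerD2l -[cos (s - s0)]cos_norm.
  by apply: cos_decr => //; lra.
have Qmid (s : R) : `|s - s0| <= e -> 0 <= Q s.
  move=> hs; have : cos e <= cos (s - s0).
    by rewrite -[cos (s - s0)]cos_norm; apply: cos_decr => //; lra.
  by rewrite /Q; lra.
have Qout (s : R) : 0 <= s <= 2 * pi -> e <= `|s - s0| -> `|Q s| <= 1.
  move=> /andP[h0 h1] hs; have : cos (s - s0) <= cos e.
    rewrite -[cos (s - s0)]cos_norm; apply: cos_le_far => //; first lra.
    by rewrite ler_norml; apply/andP; split; lra.
  have := cos_geN1 (s - s0); have := cos_le1 e; have := cos_geN1 e.
  by rewrite /Q ler_norml => *; apply/andP; split; lra.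
have [M M0 FM] : exists2 M : R, 0 <= M & forall s, 0 <= s <= 2 * pi -> `|F s| <= M.
  have /compact_bounded[M [_ hM]] : compact (F @` `[0, 2 * pi]).
    by apply: continuous_compact; [exact: continuous_subspaceT|exact: segment_compact].
  exists (`|M| + 1); first by rewrite addr_ge0.
  move=> s hs; apply: (hM (`|M| + 1)); first by rewrite (le_lt_trans (ler_norm M)) // ltrDl.
  by exists s; rewrite //= in_itv.
(* On I the kernel is at least q > 1; on D the integrand is at least - M, since
   there either F and the kernel are nonnegative or the kernel is at most 1 in
   absolute value. *)
pose I : set R := `[s0 - e / 2, s0 + e / 2]%classic.
pose D : set R := `[0, 2 * pi]%classic `\` I.
have IE (s : R) : I s <-> `|s - s0| <= e / 2.
  by rewrite /I /= in_itv /= ler_norml; split => /andP[? ?]; apply/andP; split; lra.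
have UE : `[0, 2 * pi]%classic = I `|` D.
  apply/esym; rewrite /D setDUK // => s /IE; rewrite /= in_itv /= ler_norml => /andP[? ?].
  by apply/andP; split; lra.
have mI : measurable (I : set (measurableTypeR R)) by exact: measurable_itv.
have mD : measurable (D : set (measurableTypeR R)).
  by apply: measurableD => //; exact: measurable_itv.
pose m : R := fine (lebesgue_measure D).
pose K := c * e.
have K0 : 0 < K by rewrite mulr_gt0.
have key (n : nat) : K * q ^+ n <= M * m.
  have [cG oG] := @circle_orthogonal_kernel R F s0 (1 - cos e) n cF oF.
  have := (oG 0).1; rewrite (_ : (fun s => _) = (fun s => F s * Q s ^+ n)); last first.
    by apply/funext => s; rewrite mul0r cos0 mulr1.
  have iG : lebesgue_measure.-integrable (I `|` D) (EFin \o (fun s => F s * Q s ^+ n)).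
    by rewrite -UE; exact: circle_integrable.
  rewrite /circle_integral UE Rintegral_setU //; last first.
    by apply/disj_setPS => s [hs [_]].
  have h1 : K * q ^+ n <= \int[lebesgue_measure]_(s in I) (F s * Q s ^+ n).
    have -> : K * q ^+ n = \int[lebesgue_measure]_(s in I) (c * q ^+ n).
      rewrite Rintegral_cst //= /I lebesgue_measure_itv /= lte_fin.
      by rewrite (_ : _ < _) /= /K; [field|lra].
    apply: le_Rintegral => [//| | |s /IE hs].
    - by apply: continuous_compact_integrable; [exact: segment_compact|
        apply: continuous_subspaceT => s; exact: cvg_cst].
    - by apply: integrableS iG => //; exact: measurableU.
    - have hse : `|s - s0| <= e by lra.
      apply: ler_pM; [exact: ltW| |exact: Fc|].
      + by rewrite exprn_ge0 //; lra.
      + by apply: lerXn2r; rewrite ?nnegrE; [lra|have := Qin _ hs; lra|exact: Qin].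
  have h2 : - (M * m) <= \int[lebesgue_measure]_(s in D) (F s * Q s ^+ n).
    rewrite -mulNr -Rintegral_cst //.
    apply: le_Rintegral => [//| | |s [hs1 hs2]].
    - apply: (@integrableS _ _ _ lebesgue_measure `[0, 2 * pi]%classic) => //.
        by rewrite UE; exact: subsetUr.
      by apply: circle_integrable => s; exact: cvg_cst.
    - by apply: integrableS iG => //; exact: measurableU.
    - move: hs1; rewrite /= in_itv /= => hs1.
      case: (leP `|s - s0| e) => hse.
        apply: (@le_trans _ _ 0); first by rewrite oppr_le0.
        by rewrite mulr_ge0 // ?exprn_ge0 ?Qmid // (le_trans (ltW c0)) ?Fc.
      have : `|F s * Q s ^+ n| <= M.
        rewrite normrM normrX -[M]mulr1 ler_pM //; first exact: FM.
        by rewrite exprn_ile1 // Qout // ltW.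
      by rewrite ler_norml => /andP[].
  have sum0 (x y u v : R) : x <= u -> - y <= v -> u + v = 0 -> x <= y.
    by move=> *; lra.
  exact: sum0.
(* Bernoulli's inequality makes the left side of key unbounded in n. *)
have bern (n : nat) : 1 + n%:R * (q - 1) <= q ^+ n.
  elim: n => [|n IH]; first by rewrite mul0r addr0.
  rewrite exprS -natr1; have : q * (1 + n%:R * (q - 1)) <= q * q ^+ n.
    by apply: ler_wpM2l => //; lra.
  have : 0 <= n%:R * (q - 1) * (q - 1) by rewrite -mulrA mulr_ge0 // -expr2 sqr_ge0.
  by lra.
pose n := Num.bound (M * m / (K * (q - 1))).
have : M * m / (K * (q - 1)) < n%:R.
  apply: archi_boundP; rewrite divr_ge0 //; first by rewrite mulr_ge0 // fine_ge0.
  by rewrite mulr_ge0 ?subr_ge0 ?ltW.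
rewrite ltr_pdivrMr ?mulr_gt0 ?subr_gt0 // => hn.
have := le_trans (ler_wpM2l (ltW K0) (bern n)) (key n).
rewrite mulrDr mulr1 mulrCA; apply/negP; rewrite -ltNge.
by apply: (lt_le_trans hn); rewrite lerDr ltW.
Qed.

(** Continuity carries the vanishing from the open period to its endpoints. *)
Lemma circle_orthogonal_eq0 F (s : R) : continuous F -> circle_orthogonal F ->
  0 <= s <= 2 * pi -> F s = 0.
Proof.
move=> cF oF /andP[s0 s1]; have p0 : 0 < pi :> R := pi_gt0 R.
have inner (u : R) : 0 < u < 2 * pi -> F u = 0.
  move=> hu; apply/eqP; rewrite eq_le circle_orthogonal_le0 //=.
  rewrite -oppr_le0; have := @circle_orthogonal_le0 (fun s => (-1) * F s + 0 * F s) u.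
  rewrite mulN1r mul0r addr0; apply => //; first exact: continuous_lin.
  exact: circle_orthogonal_lin.
apply/eqP/negP => /negP Fs.
have Fs0 : 0 < `|F s| by rewrite normr_gt0.
have /nbhs_ballP[del /= del0 hdel] := cF s _ (nbhsx_ballx _ _ Fs0).
have [u hu us] : exists2 u : R, 0 < u < 2 * pi & `|s - u| < del.
  pose m := Num.min (del / 2) (pi / 2).
  have m0 : 0 < m by rewrite lt_min !divr_gt0.
  have m1 : m <= del / 2 by rewrite ge_min lexx.
  have m2 : m <= pi / 2 by rewrite ge_min lexx orbT.
  case: (leP s pi) => sp.
    exists (s + m); first by apply/andP; split; lra.
    by rewrite opprD addrA subrr add0r normrN gtr0_norm //; lra.
  exists (s - m); first by apply/andP; split; lra.
  by rewrite opprB addrCA subrr addr0 gtr0_norm //; lra.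
have := hdel u us; rewrite /ball /= (inner u hu) subr0.
by rewrite ltxx.
Qed.

End CircleUnique.

(** * Fourier coefficients on the torus *)

Section Fourier.
Context (R : realType).

Definition phase d (k : 'rV[int]_d) (x : 'rV[R]_d) : R := dotp (freq R k) x.

Lemma phase_scons d (k : 'rV[int]_(1 + d)) (s : R) (y : 'rV[R]_d) :
  phase k (scons s y) = (lsubmx k 0 0)%:~R * s + phase (rsubmx k) y.
Proof.
rewrite /phase /dotp (@big_split_ord _ _ _ 1 d) big_ord1 /=; congr (_ + _).
  by rewrite /scons row_mxEl !mxE.
by apply: eq_bigr => i _; rewrite /scons row_mxEr !mxE.
Qed.

Lemma phaseD d (k l : 'rV[int]_d) x : phase (k + l) x = phase k x + phase l x.
Proof.
rewrite /phase /dotp -big_split; apply: eq_bigr => i _ /=.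
by rewrite !mxE intrD mulrDl.
Qed.

Lemma phaseN d (k : 'rV[int]_d) x : phase (- k) x = - phase k x.
Proof.
rewrite /phase /dotp -sumrN; apply: eq_bigr => i _ /=.
by rewrite !mxE intrN mulNr.
Qed.

Lemma phase0 d x : phase (0 : 'rV[int]_d) x = 0.
Proof. by rewrite /phase /dotp big1 // => i _; rewrite !mxE mul0r. Qed.

Lemma phase_shift d (k l : 'rV[int]_d) (x : 'rV[R]_d) :
  exists m : int, phase k (x + (2 * pi) *: freq R l) = phase k x + m%:~R * (2 * pi).
Proof.
exists (\sum_i k 0 i * l 0 i).
rewrite /phase /dotp (big_morph _ (@intrD R) (mulr0z 1)) mulr_suml -big_split.
by apply: eq_bigr => i _ /=; rewrite !mxE intrM; ring.
Qed.

Lemma continuous_phase d (k : 'rV[int]_d) : continuous (phase k).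
Proof.
have -> : phase k = (fun x => \sum_(i <- index_enum 'I_d) freq R k 0 i * x 0 i) by [].
apply: (@continuous_sum R 'rV[R]_d 'I_d) => i.
apply: (@continuous_mul R _ (fun=> freq R k 0 i)) => x.
  exact: cst_continuous.
exact: (@coord_continuous R 1 d 0 i x).
Qed.

Lemma continuous_cos_phase d (k : 'rV[int]_d) :
  continuous (fun x => cos (phase k x)).
Proof.
move=> x; apply: (@continuous_comp _ _ _ (phase k) cos).
  exact: continuous_phase.
exact: continuous_cos.
Qed.

Lemma continuous_sin_phase d (k : 'rV[int]_d) :
  continuous (fun x => sin (phase k x)).
Proof.
move=> x; apply: (@continuous_comp _ _ _ (phase k) sin).
  exact: continuous_phase.
exact: continuous_sin.
Qed.

Lemma torus_integral_phase d (k : 'rV[int]_d) :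
  torus_integral (fun x => cos (phase k x)) = (k == 0)%:R * (2 * pi) ^+ d /\
  torus_integral (fun x => sin (phase k x)) = 0.
Proof.
elim: d k => [|d IH] k.
  have -> : k = 0 by apply/rowP => -[].
  by rewrite /= phase0 cos0 sin0 eqxx mulr1.
pose a := lsubmx (k : 'rV_(1 + d)) 0 0; pose l := rsubmx (k : 'rV_(1 + d)).
have k0 : (k == 0) = (a == 0) && (l == 0).
  apply/eqP/andP => [k00|[/eqP a0 /eqP l0]].
    by rewrite /a /l k00 !mxE; split=> //; apply/eqP/rowP => i; rewrite !mxE.
  apply: (etrans (esym (@hsubmxK _ 1 1 d k))).
  rewrite -/l l0 -(@row_mx0 _ 1 1 d); congr row_mx.
  by apply/rowP => i; rewrite ord1 !mxE -[RHS]a0 /a !mxE.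
have [Hc Hs] := IH l.
have cc := @continuous_cos_phase d l; have cs := @continuous_sin_phase d l.
split; rewrite /=.
- transitivity (circle_integral (fun s : R => ((l == 0)%:R * (2 * pi) ^+ d) * cos (a%:~R * s)
      + 0 * cos (a%:~R * s))).
    congr Rintegral; apply/funext => s; rewrite mul0r addr0.
    transitivity (torus_integral (fun y : 'rV[R]_d =>
        cos (a%:~R * s) * cos (phase l y) + (- sin (a%:~R * s)) * sin (phase l y))).
      congr torus_integral; apply/funext => y.
      by rewrite -/(scons s y) phase_scons cosD mulNr.
    by rewrite torus_integral_lin // Hc Hs mulr0 addr0 mulrC.
  rewrite circle_integral_lin; try exact: continuous_cosn.
  rewrite circle_integral_cos k0 exprS mul0r addr0.
  by case: (a == 0); case: (l == 0); rewrite /= ?mulr1n ?mulr0n; ring.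
- transitivity (circle_integral (fun s : R => ((l == 0)%:R * (2 * pi) ^+ d) * sin (a%:~R * s)
      + 0 * sin (a%:~R * s))).
    congr Rintegral; apply/funext => s; rewrite mul0r addr0.
    transitivity (torus_integral (fun y : 'rV[R]_d =>
        sin (a%:~R * s) * cos (phase l y) + cos (a%:~R * s) * sin (phase l y))).
      congr torus_integral; apply/funext => y.
      by rewrite -/(scons s y) phase_scons sinD.
    by rewrite torus_integral_lin // Hc Hs mulr0 addr0 mulrC.
  rewrite circle_integral_lin; try exact: continuous_sinn.
  by rewrite circle_integral_sin !mulr0 addr0.
Qed.

(** The real part of the Fourier coefficient and the opposite of its imaginary
    part: all estimates are done on this pair, with real integrals only. *)
Definition cos_coef d (f : 'rV[R]_d -> R) (k : 'rV[int]_d) : R :=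
  torus_integral (fun x => f x * cos (phase k x)).
Definition sin_coef d (f : 'rV[R]_d -> R) (k : 'rV[int]_d) : R :=
  torus_integral (fun x => f x * sin (phase k x)).

Lemma fourier_coefs d (f : 'rV[R]_d -> R) k :
  fourier f k = (cos_coef f k +i* (- sin_coef f k))%C.
Proof. by []. Qed.

Section Coef.
Context (d : nat).
Implicit Types (f g : 'rV[R]_d -> R) (k : 'rV[int]_d).

Lemma cos_coefN f k : cos_coef f (- k) = cos_coef f k.
Proof. by congr torus_integral; apply/funext => x; rewrite phaseN cosN. Qed.

Lemma sin_coefN f k : continuous f -> sin_coef f (- k) = - sin_coef f k.
Proof.
move=> cf; rewrite /sin_coef -mulN1r -torus_integralZ; last first.
  by apply: continuous_mul => //; exact: continuous_sin_phase.
by congr torus_integral; apply/funext => x; rewrite phaseN sinN mulN1r mulrN.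
Qed.

Lemma cos_coef_lin (a b : R) f g k : continuous f -> continuous g ->
  cos_coef (fun x => a * f x + b * g x) k = a * cos_coef f k + b * cos_coef g k.
Proof.
move=> cf cg; rewrite /cos_coef -torus_integral_lin; last 2 first.
- by apply: continuous_mul => //; exact: continuous_cos_phase.
- by apply: continuous_mul => //; exact: continuous_cos_phase.
by congr torus_integral; apply/funext => x; rewrite mulrDl !mulrA.
Qed.

Lemma sin_coef_lin (a b : R) f g k : continuous f -> continuous g ->
  sin_coef (fun x => a * f x + b * g x) k = a * sin_coef f k + b * sin_coef g k.
Proof.
move=> cf cg; rewrite /sin_coef -torus_integral_lin; last 2 first.
- by apply: continuous_mul => //; exact: continuous_sin_phase.
- by apply: continuous_mul => //; exact: continuous_sin_phase.
by congr torus_integral; apply/funext => x; rewrite mulrDl !mulrA.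
Qed.

Lemma cos_coef_close f g k e : continuous f -> continuous g ->
  (forall x, `|f x - g x| <= e) ->
  `|cos_coef f k - cos_coef g k| <= (2 * pi) ^+ d * e.
Proof.
move=> cf cg fg; apply: torus_integral_close.
- by apply: continuous_mul => //; exact: continuous_cos_phase.
- by apply: continuous_mul => //; exact: continuous_cos_phase.
- move=> x _; rewrite -mulrBl normrM -[e]mulr1 ler_pM //; exact: cos_max.
Qed.

Lemma sin_coef_close f g k e : continuous f -> continuous g ->
  (forall x, `|f x - g x| <= e) ->
  `|sin_coef f k - sin_coef g k| <= (2 * pi) ^+ d * e.
Proof.
move=> cf cg fg; apply: torus_integral_close.
- by apply: continuous_mul => //; exact: continuous_sin_phase.
- by apply: continuous_mul => //; exact: continuous_sin_phase.
- move=> x _; rewrite -mulrBl normrM -[e]mulr1 ler_pM //; exact: sin_max.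
Qed.

End Coef.

(** Integrating out all variables but the first leaves functions of one variable
    that inherit the orthogonality: the frequencies a and - a of the first
    variable separate the two terms of the addition formulas. *)
Lemma fourier_unique_box d (f : 'rV[R]_d -> R) : continuous f ->
  (forall k, cos_coef f k = 0 /\ sin_coef f k = 0) ->
  forall x, box x -> f x = 0.
Proof.
elim: d f => [|d IH] f cf Hf x hx.
  have [+ _] := Hf 0; rewrite /cos_coef /= phase0 cos0 mulr1.
  by rewrite (_ : x = 0) //; apply/rowP => -[].
pose s := lsubmx (x : 'rV_(1 + d)) 0 0; pose y := rsubmx (x : 'rV_(1 + d)).
have xE : x = scons s y.
  apply: (etrans (esym (@hsubmxK _ 1 1 d x))); congr row_mx.
  by apply/rowP => i; rewrite ord1 [RHS]mxE.
have hs : 0 <= s <= 2 * pi by rewrite /s mxE; exact: hx.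
have hy : box y by move=> i; rewrite /y mxE; exact: hx.
rewrite xE; move: y hy {xE hx}; apply: (IH (fun y => f (scons s y))).
  exact: (@continuous_slice_l R d).
move=> l.
pose Gc s := cos_coef (fun y : 'rV[R]_d => f (scons s y)) l.
pose Gs s := sin_coef (fun y : 'rV[R]_d => f (scons s y)) l.
have cph k : continuous (fun x : 'rV[R]_(1 + d) => f x * cos (phase k x)).
  by apply: continuous_mul => //; exact: (@continuous_cos_phase (1 + d)).
have sph k : continuous (fun x : 'rV[R]_(1 + d) => f x * sin (phase k x)).
  by apply: continuous_mul => //; exact: (@continuous_sin_phase (1 + d)).
pose k0 a : 'rV[int]_(1 + d) := row_mx (\row_(_ < 1) a) l.
have phk a u (v : 'rV[R]_d) : phase (k0 a) (scons u v) = a%:~R * u + phase l v.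
  by rewrite phase_scons /k0 row_mxKl row_mxKr mxE.
have cf1 u := @continuous_slice_l R d f u cf.
have cfc u : continuous (fun v : 'rV[R]_d => f (scons u v) * cos (phase l v)).
  by apply: continuous_mul; [exact: cf1|exact: continuous_cos_phase].
have cfs u : continuous (fun v : 'rV[R]_d => f (scons u v) * sin (phase l v)).
  by apply: continuous_mul; [exact: cf1|exact: continuous_sin_phase].
have E0 u v : phase (k0 0) (scons u v) = phase l v by rewrite phk mul0r add0r.
have cGc : continuous Gc.
  have := continuous_inner_integral (cph (k0 0)); rewrite /Gc /cos_coef.
  by under [X in continuous X]eq_fun => u do under [X in torus_integral X]eq_fun => v do rewrite E0.
have cGs : continuous Gs.
  have := continuous_inner_integral (sph (k0 0)); rewrite /Gs /sin_coef.
  by under [X in continuous X]eq_fun => u do under [X in torus_integral X]eq_fun => v do rewrite E0.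
have I1 a : circle_integral (fun u => Gc u * cos (a%:~R * u)) -
            circle_integral (fun u => Gs u * sin (a%:~R * u)) = 0.
  have [<- _] := Hf (k0 a); rewrite -[X in X - _]mul1r -mulN1r -circle_integral_lin; last 2 first.
  - by apply: continuous_mul => //; exact: continuous_cosn.
  - by apply: continuous_mul => //; exact: continuous_sinn.
  congr Rintegral; apply/funext => u.
  transitivity (torus_integral (fun v : 'rV[R]_d =>
    cos (a%:~R * u) * (f (scons u v) * cos (phase l v)) +
    (- sin (a%:~R * u)) * (f (scons u v) * sin (phase l v)))).
    by rewrite torus_integral_lin // /Gc /Gs /cos_coef /sin_coef; ring.
  congr torus_integral; apply/funext => v.
  by rewrite -/(scons u v) phk cosD; ring.
have I2 a : circle_integral (fun u => Gc u * sin (a%:~R * u)) +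
            circle_integral (fun u => Gs u * cos (a%:~R * u)) = 0.
  have [_ <-] := Hf (k0 a); rewrite -[X in X + _]mul1r -[X in _ + X]mul1r -circle_integral_lin; last 2 first.
  - by apply: continuous_mul => //; exact: continuous_sinn.
  - by apply: continuous_mul => //; exact: continuous_cosn.
  congr Rintegral; apply/funext => u.
  transitivity (torus_integral (fun v : 'rV[R]_d =>
    sin (a%:~R * u) * (f (scons u v) * cos (phase l v)) +
    cos (a%:~R * u) * (f (scons u v) * sin (phase l v)))).
    by rewrite torus_integral_lin // /Gc /Gs /cos_coef /sin_coef; ring.
  congr torus_integral; apply/funext => v.
  by rewrite -/(scons u v) phk sinD; ring.
have NC (G : R -> R) (a : int) : circle_integral (fun u : R => G u * cos ((- a)%:~R * u)) =
    circle_integral (fun u => G u * cos (a%:~R * u)).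
  by congr circle_integral; apply/funext => u; rewrite intrN mulNr cosN.
have NS (G : R -> R) (a : int) : continuous G -> circle_integral (fun u : R => G u * sin ((- a)%:~R * u)) =
    - circle_integral (fun u => G u * sin (a%:~R * u)).
  move=> cG; have c1 : continuous (fun u => G u * sin (a%:~R * u)).
    by apply: continuous_mul => //; exact: continuous_sinn.
  transitivity ((-1) * circle_integral (fun u => G u * sin (a%:~R * u)) +
      0 * circle_integral (fun u => G u * sin (a%:~R * u))); last first.
    by rewrite mulN1r mul0r addr0.
  rewrite -circle_integral_lin //.
  by congr circle_integral; apply/funext => u; rewrite intrN mulNr sinN; ring.
(* Changing a into - a flips the sign of the sine integrals only. *)
split.
- apply: (@circle_orthogonal_eq0 R Gc s) => // a.
  move: (I1 a) (I1 (- a)) (I2 a) (I2 (- a)); rewrite !NC !NS //.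
  move: (circle_integral _) (circle_integral _) (circle_integral _) (circle_integral _).
  by clear=> *; split; lra.
- apply: (@circle_orthogonal_eq0 R Gs s) => // a.
  move: (I1 a) (I1 (- a)) (I2 a) (I2 (- a)); rewrite !NC !NS //.
  move: (circle_integral _) (circle_integral _) (circle_integral _) (circle_integral _).
  by clear=> *; split; lra.
Qed.

Lemma periodic_box d (f : 'rV[R]_d -> R) (x : 'rV[R]_d) :
  torus_function f -> exists2 y, box y & f x = f y.
Proof.
move=> [_ pf]; pose k : 'rV[int]_d := \row_i (- Num.floor (x 0 i / (2 * pi))).
exists (x + (2 * pi) *: freq R k); last by rewrite pf.
move=> i; rewrite !mxE intrN; have p0 := twopi_gt0 R.
have := floor_le (x 0 i / (2 * pi)); have := floorD1_gt (x 0 i / (2 * pi)).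
rewrite intrD ltr_pdivrMr // ler_pdivlMr // => h1 h2.
by apply/andP; split; lra.
Qed.

Lemma torus_fourier_unique d (f g : 'rV[R]_d -> R) : torus_function f ->
  torus_function g ->
  (forall k, cos_coef f k = cos_coef g k /\ sin_coef f k = sin_coef g k) ->
  f = g.
Proof.
move=> [cf pf] [cg pg] fg; apply/funext => x.
pose h x := 1 * f x + (-1) * g x.
have ch : continuous h by exact: continuous_lin.
have th : torus_function h by split=> // {}x k; rewrite /h pf pg.
have [y hy hxy] := periodic_box x th.
have : h y = 0.
  apply: fourier_unique_box hy => // k; have [e1 e2] := fg k.
  by rewrite cos_coef_lin // sin_coef_lin // e1 e2 mul1r mulN1r subrr mul1r mulN1r subrr.
by rewrite -hxy /h mul1r mulN1r => /eqP; rewrite subr_eq0 => /eqP.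
Qed.

End Fourier.

(** * Absolutely convergent Fourier series *)

Section UniformLimits.
Context (R : realType).

Definition ucvg (T : Type) (u : nat -> T -> R) (f : T -> R) : Prop :=
  forall e, 0 < e -> exists N, forall n, (N <= n)%N -> forall x,
    `|f x - u n x| <= e.

Lemma ucvg_continuous (T : topologicalType) (u : nat -> T -> R) (f : T -> R) :
  (forall n, continuous (u n)) -> ucvg u f -> continuous f.
Proof.
move=> cu uf x; apply/cvgrPdist_le => e e0.
have e30 : 0 < e / 3 by rewrite divr_gt0.
have [N hN] := uf _ e30.
have /cvgrPdist_le/(_ _ e30) := cu N x.
apply: filterS => y hy.
have -> : f x - f y = (f x - u N x) + (u N x - u N y) - (f y - u N y) by ring.
have h1 := hN N (leqnn N) x; have h2 := hN N (leqnn N) y.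
rewrite (le_trans (ler_normB _ _)) // (_ : e = (e / 3 + e / 3) + e / 3); last by field.
by apply: lerD => //; rewrite (le_trans (ler_normD _ _)) // lerD.
Qed.

Lemma ucvg_cvg (T : Type) (u : nat -> T -> R) (f : T -> R) x : ucvg u f ->
  (fun n => u n x) @ \oo --> f x.
Proof.
move=> uf; apply/cvgrPdist_le => e e0; have [N hN] := uf e e0.
by near=> n; apply: hN; near: n; exact: nbhs_infty_ge.
Unshelve. all: by end_near.
Qed.

Lemma ucvg_torus d (u : nat -> 'rV[R]_d -> R) (f : 'rV[R]_d -> R) :
  (forall n, torus_function (u n)) -> ucvg u f -> torus_function f.
Proof.
move=> tu uf; split.
  by apply: ucvg_continuous uf => n; exact: (tu n).1.
move=> x k; have h1 := @ucvg_cvg _ _ _ (x + (2 * pi) *: freq R k) uf.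
have h2 := @ucvg_cvg _ _ _ x uf.
rewrite (_ : (fun n => u n (x + _)) = (fun n => u n x)) in h1; last first.
  by apply/funext => n; rewrite (tu n).2.
by apply: (@cvg_unique R^o _ ((fun n => u n x) @ \oo)) => //; exact: fmap_proper_filter.
Qed.

Lemma ucvg_coef d (u : nat -> 'rV[R]_d -> R) (f : 'rV[R]_d -> R) k :
  (forall n, continuous (u n)) -> ucvg u f ->
  (fun n => cos_coef (u n) k) @ \oo --> cos_coef f k /\
  (fun n => sin_coef (u n) k) @ \oo --> sin_coef f k.
Proof.
move=> cu uf; have cf := ucvg_continuous cu uf.
have P0 : 0 < (2 * pi) ^+ d :> R by rewrite exprn_gt0 // twopi_gt0.
split; apply/cvgrPdist_le => e e0.
  have [|N hN] := uf (e / (2 * pi) ^+ d); first by rewrite divr_gt0.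
  exists N => // n /= Nn.
  rewrite -(@divfK _ ((2 * pi) ^+ d) _ e) ?gt_eqF // mulrC.
  by apply: cos_coef_close => //; exact: hN.
have [|N hN] := uf (e / (2 * pi) ^+ d); first by rewrite divr_gt0.
exists N => // n /= Nn.
rewrite -(@divfK _ ((2 * pi) ^+ d) _ e) ?gt_eqF // mulrC.
by apply: sin_coef_close => //; exact: hN.
Qed.

End UniformLimits.

Section Enumeration.
Context (I : countType).

(** The elements of code less than N: partial sums of series indexed by a
    countable type are taken along these sequences. *)
Definition firsts (N : nat) : seq I := pmap pickle_inv (iota 0 N).

Lemma firsts_uniq N : uniq (firsts N).
Proof.
apply: (@pmap_uniq _ _ _ (@pickle I)) (iota_uniq _ _).
by move=> n; have := @pickle_invK I n; case: (pickle_inv n).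
Qed.

Lemma mem_firsts N (k : I) : (k \in firsts N) = (pickle k < N)%N.
Proof.
rewrite mem_pmap; apply/mapP/idP => [[n]|kN].
  rewrite mem_iota /= add0n => nN /esym nk.
  by have := @pickle_invK I n; rewrite nk /= => ->.
by exists (pickle k); rewrite ?mem_iota ?pickleK_inv.
Qed.

Lemma firsts_cat N m : firsts (N + m) = firsts N ++ pmap pickle_inv (iota N m).
Proof. by rewrite /firsts iotaD pmap_cat. Qed.

End Enumeration.

Section MTest.
Context (R : realType) (I : countType).

(** This elementary form of summability is all that finite Fourier sums need;
    it is compared with sums in the extended reals only at the very end. *)
Definition summable_by (b : I -> R) (B : R) : Prop :=
  forall s : seq I, uniq s -> \sum_(k <- s) b k <= B.

Lemma weierstrass_M (T : Type) (F : I -> T -> R) (b : I -> R) (B : R) :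
  summable_by b B -> (forall k x, `|F k x| <= b k) ->
  exists f, ucvg (fun N x => \sum_(k <- firsts I N) F k x) f.
Proof.
move=> bB Fb; have b0 (k : I) (x : T) : 0 <= b k := le_trans (normr_ge0 _) (Fb k x).
pose P N : R := \sum_(k <- firsts I N) b k.
case: (pselect (inhabited T)) => [[x0]|noT]; last first.
  by exists (fun=> 0) => e e0; exists 0%N => n _ x; case: noT; exists.
have ndP : nondecreasing_seq P.
  move=> N M NM; rewrite -(subnKC NM) /P firsts_cat big_cat /= lerDl.
  by apply: sumr_ge0 => k _; exact: (b0 k x0).
have cP : cvgn P.
  apply: nondecreasing_is_cvgn => //; exists B => _ [N _ <-].
  by apply: bB; exact: firsts_uniq.
pose S N x := \sum_(k <- firsts I N) F k x.
(* S + P is nondecreasing and bounded, which avoids Cauchy sequences. *)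
have cS x : cvgn (S ^~ x).
  have -> : S ^~ x = (fun N => (S N x + P N) - P N) by apply/funext => N; ring.
  apply: is_cvgB => //; apply: nondecreasing_is_cvgn.
    move=> N M NM; rewrite -(subnKC NM) /S /P firsts_cat !big_cat /= addrACA lerDl.
    rewrite -big_split; apply: sumr_ge0 => k _ /=.
    by have := Fb k x; rewrite ler_norml => /andP[+ _]; lra.
  exists (B + B) => _ [N _ <-]; apply: lerD; last by apply: bB; exact: firsts_uniq.
  apply: le_trans (bB _ (firsts_uniq _ N)); apply: ler_sum => k _.
  by apply: le_trans (Fb k x); exact: ler_norm.
exists (fun x => limn (S ^~ x)) => e e0.
have /cvgrPdist_le/(_ e e0)[N _ hN] : P @ \oo --> limn P by exact: cP.
exists N => n Nn x.
apply: (@le_trans _ _ (`|limn P - P n|)); last exact: hN.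
rewrite [leRHS]ger0_norm; last by rewrite subr_ge0; apply: nondecreasing_cvgn_le.
have cSn : (fun m => `|S m x - S n x|) @ \oo --> `|limn (S ^~ x) - S n x|.
  by apply: cvg_norm; apply: cvgB; [exact: cS|exact: cvg_cst].
have := limr_le (cvgP _ cSn); rewrite (cvg_lim _ cSn) //; apply.
near=> m; have nm : (n <= m)%N by near: m; exact: nbhs_infty_ge.
apply: (@le_trans _ _ (P m - P n)); last first.
  by rewrite lerD2r; apply: nondecreasing_cvgn_le.
rewrite -(subnKC nm) /S /P firsts_cat !big_cat /= [X in `|X|]addrAC subrr add0r.
rewrite [X in _ <= X]addrAC subrr add0r.
by rewrite (le_trans (ler_norm_sum _ _ _)) //; apply: ler_sum.
Unshelve. all: by end_near.
Qed.

End MTest.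

Section SummableSequences.
Context (R : realType).

Lemma firsts_nat N : firsts nat N = iota 0 N.
Proof.
rewrite /firsts; elim: (iota 0 N) => //= n s ->.
have -> : pickle_inv n = Some n :> option nat by exact: (pickleK_inv n).
by [].
Qed.

Lemma summable_byZ (I : countType) (a B : R) (b : I -> R) : 0 <= a ->
  summable_by b B -> summable_by (fun i => a * b i) (a * B).
Proof. by move=> a0 bB s us; rewrite -mulr_sumr ler_wpM2l ?bB. Qed.

Lemma ler_sum_sub (I : eqType) (s t : seq I) (F : I -> R) : uniq s -> uniq t ->
  {subset s <= t} -> (forall i, 0 <= F i) ->
  \sum_(i <- s) F i <= \sum_(i <- t) F i.
Proof.
move=> us ut st F0.
rewrite -(perm_big _ (introT permPl (perm_filterC (mem s) t))) big_cat /=.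
have pe : perm_eq s [seq i <- t | mem s i].
  apply: uniq_perm => [//||i]; first by rewrite filter_uniq.
  by rewrite mem_filter /=; case: (boolP (i \in s)) => // /st ->.
by rewrite (perm_big _ pe) /= lerDl; apply: sumr_ge0.
Qed.

Lemma geometric_summable : summable_by (fun n : nat => 2^-1 ^+ n : R) 2.
Proof.
move=> s us; pose M := (\max_(n <- s) n).+1.
apply: (@le_trans _ _ (\sum_(n <- iota 0 M) 2^-1 ^+ n : R)).
  apply: ler_sum_sub => [//||n ns|n]; first exact: iota_uniq.
    by rewrite mem_iota /= add0n ltnS; exact: leq_bigmax_seq.
  by rewrite exprn_ge0 // invr_ge0.
have E m : \sum_(n <- iota 0 m) 2^-1 ^+ n = 2 - 2 * 2^-1 ^+ m :> R.
  elim: m => [|m IH]; first by rewrite big_nil expr0; ring.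
  by rewrite -addn1 iotaD big_cat big_seq1 /= IH add0n exprD expr1; field.
by rewrite E gerBl mulr_ge0 // exprn_ge0 // invr_ge0.
Qed.

End SummableSequences.

Section Synthesis.
Context (R : realType) (d : nat).
Implicit Types (c s : 'rV[int]_d -> R) (f : 'rV[R]_d -> R) (k l : 'rV[int]_d).

Definition trig_term c s l (x : 'rV[R]_d) : R :=
  (2 * pi) ^- d * (c l * cos (phase l x) + s l * sin (phase l x)).

Definition trig_sum c s (N : nat) (x : 'rV[R]_d) : R :=
  \sum_(l <- firsts 'rV[int]_d N) trig_term c s l x.

Lemma trig_term_torus c s l : torus_function (trig_term c s l).
Proof.
split.
  have cc := @continuous_lin R _ (c l) (s l) _ _ (@continuous_cos_phase R d l)
    (@continuous_sin_phase R d l).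
  by apply: (@continuous_mul R _ (fun=> (2 * pi) ^- d)) => // x; exact: cst_continuous.
move=> x k; rewrite /trig_term; have [m ->] := phase_shift l k x.
by have [-> ->] := trig_int_shift m (phase l x).
Qed.

Lemma trig_sum_torus c s N : torus_function (trig_sum c s N).
Proof.
split; first by apply: continuous_sum => l; exact: (trig_term_torus c s l).1.
move=> x k; apply: eq_bigr => l _; exact: (trig_term_torus c s l).2.
Qed.

Lemma big_delta (K : eqType) (r : seq K) (F : K -> R) (k : K) : uniq r ->
  \sum_(l <- r) (l == k)%:R * F l = (k \in r)%:R * F k.
Proof.
move=> ur; case: (boolP (k \in r)) => kr.
  rewrite (bigD1_seq k) //= eqxx big1 ?addr0 // => l /negPf->.
  by rewrite mul0r.
rewrite mul0r big_seq big1 // => l lr; case: eqP => [lk|]; last by rewrite mul0r.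
by rewrite -lk lr in kr.
Qed.

Lemma twopiX_neq0 : (2 * pi) ^+ d != 0 :> R.
Proof. by rewrite expf_neq0 // gt_eqF // twopi_gt0. Qed.

Lemma trig_term_coef c s l k :
  cos_coef (trig_term c s l) k =
    2^-1 * ((l == k)%:R * c l + (l == - k)%:R * c l) /\
  sin_coef (trig_term c s l) k =
    2^-1 * ((l == k)%:R * s l - (l == - k)%:R * s l).
Proof.
have cc m := @continuous_cos_phase R d m; have cs m := @continuous_sin_phase R d m.
have p0 := twopiX_neq0.
have [Ic1 Is1] := torus_integral_phase R (l - k).
have [Ic2 Is2] := torus_integral_phase R (l + k).
rewrite subr_eq0 in Ic1; rewrite addr_eq0 in Ic2.
split.
- transitivity (torus_integral (fun x : 'rV[R]_d =>
    ((2 * pi) ^- d * 2^-1 * c l) * (1 * cos (phase (l - k) x) + 1 * cos (phase (l + k) x)) +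
    ((2 * pi) ^- d * 2^-1 * s l) * (1 * sin (phase (l - k) x) + 1 * sin (phase (l + k) x)))).
    congr torus_integral; apply/funext => x.
    by rewrite !phaseD phaseN cosB sinB cosD sinD /trig_term; field.
  rewrite torus_integral_lin; try exact: continuous_lin.
  rewrite !torus_integral_lin // Ic1 Ic2 Is1 Is2.
  by field.
- transitivity (torus_integral (fun x : 'rV[R]_d =>
    ((2 * pi) ^- d * 2^-1 * s l) * (1 * cos (phase (l - k) x) + (-1) * cos (phase (l + k) x)) +
    ((2 * pi) ^- d * 2^-1 * c l) * (1 * sin (phase (l + k) x) + (-1) * sin (phase (l - k) x)))).
    congr torus_integral; apply/funext => x.
    by rewrite !phaseD phaseN cosB sinB cosD sinD /trig_term; field.
  rewrite torus_integral_lin; try exact: continuous_lin.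
  rewrite !torus_integral_lin // Ic1 Ic2 Is1 Is2.
  by field.
Qed.

Lemma coef_sum (J : Type) (r : seq J) (F : J -> 'rV[R]_d -> R) k :
  (forall j, continuous (F j)) ->
  cos_coef (fun x => \sum_(j <- r) F j x) k = \sum_(j <- r) cos_coef (F j) k /\
  sin_coef (fun x => \sum_(j <- r) F j x) k = \sum_(j <- r) sin_coef (F j) k.
Proof.
move=> cF; split.
  rewrite -torus_integral_sum => [|j]; last first.
    by apply: continuous_mul; [exact: cF|exact: continuous_cos_phase].
  by congr torus_integral; apply/funext => x; rewrite mulr_suml.
rewrite -torus_integral_sum => [|j]; last first.
  by apply: continuous_mul; [exact: cF|exact: continuous_sin_phase].
by congr torus_integral; apply/funext => x; rewrite mulr_suml.
Qed.

(** Symmetry of c and antisymmetry of s merge the contributions of the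
    frequencies k and - k, each of which counts for one half. *)
Lemma trig_sum_coef c s N k :
  (forall l, c (- l) = c l) -> (forall l, s (- l) = - s l) ->
  cos_coef (trig_sum c s N) k =
    2^-1 * ((k \in firsts _ N)%:R + (- k \in firsts _ N)%:R) * c k /\
  sin_coef (trig_sum c s N) k =
    2^-1 * ((k \in firsts _ N)%:R + (- k \in firsts _ N)%:R) * s k.
Proof.
move=> ec os; have ct l := (trig_term_torus c s l).1.
have [-> ->] := coef_sum (firsts 'rV[int]_d N) k ct; split.
  rewrite (eq_bigr _ (fun l _ => (trig_term_coef c s l k).1)).
  rewrite -mulr_sumr big_split /= !big_delta ?firsts_uniq // ec.
  by ring.
rewrite (eq_bigr _ (fun l _ => (trig_term_coef c s l k).2)).
rewrite -mulr_sumr sumrB /= !big_delta ?firsts_uniq // os.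
by ring.
Qed.

Lemma fourier_synthesis c s (b : 'rV[int]_d -> R) B :
  (forall l, c (- l) = c l) -> (forall l, s (- l) = - s l) ->
  summable_by b B -> (forall l, `|c l| + `|s l| <= b l) ->
  exists f, [/\ torus_function f, ucvg (trig_sum c s) f,
    forall k, cos_coef f k = c k & forall k, sin_coef f k = s k].
Proof.
move=> ec os bB cb.
have p0 : 0 < (2 * pi) ^- d :> R by rewrite invr_gt0 exprn_gt0 // twopi_gt0.
have sb : summable_by (fun l => (2 * pi) ^- d * b l) ((2 * pi) ^- d * B).
  by move=> r ur; rewrite -mulr_sumr ler_wpM2l ?bB // ltW.
have [|f hf] := @weierstrass_M R _ _ (trig_term c s) _ _ sb.
  move=> l x; rewrite normrM gtr0_norm //; apply: ler_wpM2l; first exact: ltW.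
  apply: le_trans (cb l); rewrite (le_trans (ler_normD _ _)) // !normrM lerD //.
    by rewrite -[leRHS]mulr1 ler_wpM2l // cos_max.
  by rewrite -[leRHS]mulr1 ler_wpM2l // sin_max.
have tf : torus_function f by apply: ucvg_torus hf => N; exact: trig_sum_torus.
have lim1 k : forall (a : R) (u : nat -> R),
    (forall N, u N = 2^-1 * ((k \in firsts _ N)%:R + (- k \in firsts _ N)%:R) * a) ->
    u @ \oo --> a.
  move=> a u uE; apply: cvg_near_cst; near=> N; rewrite uE !mem_firsts.
  have -> : (pickle k < N)%N by near: N; exact: nbhs_infty_gt.
  have -> : (pickle (- k) < N)%N by near: N; exact: nbhs_infty_gt.
  by rewrite /=; field.
exists f; split=> // k.
- have [h _] := ucvg_coef k (fun N => (trig_sum_torus c s N).1) hf.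
  apply: (@cvg_unique R^o _ _ _ _ _ h) => //.
  by apply: lim1 => N; have [-> _] := @trig_sum_coef c s N k ec os.
- have [_ h] := ucvg_coef k (fun N => (trig_sum_torus c s N).1) hf.
  apply: (@cvg_unique R^o _ _ _ _ _ h) => //.
  by apply: lim1 => N; have [_ ->] := @trig_sum_coef c s N k ec os.
Unshelve. all: by end_near.
Qed.

(** The series of f converges to some function with the same coefficients as f,
    which is f by uniqueness. *)
Lemma fourier_inversion f (b : 'rV[int]_d -> R) B : torus_function f ->
  summable_by b B -> (forall l, `|cos_coef f l| + `|sin_coef f l| <= b l) ->
  ucvg (trig_sum (cos_coef f) (sin_coef f)) f.
Proof.
move=> tf bB cb.
have [g [tg ug cg sg]] := fourier_synthesis (cos_coefN f)
  (fun l => sin_coefN l tf.1) bB cb.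
have fg : f = g by apply: torus_fourier_unique => // k; rewrite cg sg.
by rewrite [X in ucvg _ X]fg.
Qed.

End Synthesis.

(** * Weighted spaces of absolutely convergent Fourier series *)

Section Pairs.
Context (R : realType).

(** The modulus of the complex number a + i b. *)
Definition hyp (a b : R) : R := Num.sqrt (a ^+ 2 + b ^+ 2).

Lemma hyp_ge0 a b : 0 <= hyp a b. Proof. exact: sqrtr_ge0. Qed.

Lemma sqr_hyp a b : hyp a b ^+ 2 = a ^+ 2 + b ^+ 2.
Proof. by rewrite sqr_sqrtr // addr_ge0 ?sqr_ge0. Qed.

Lemma hyp_eq (a b c : R) : 0 <= c -> a ^+ 2 + b ^+ 2 = c ^+ 2 -> hyp a b = c.
Proof. by move=> c0 e; rewrite /hyp e sqrtr_sqr ger0_norm. Qed.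

Lemma hyp_dot (a b x y : R) : a * x + b * y <= hyp a b * hyp x y.
Proof.
have h0 : 0 <= hyp a b * hyp x y by rewrite mulr_ge0 // hyp_ge0.
case: (leP (a * x + b * y) 0) => [h|h]; first exact: le_trans h0.
rewrite -ler_sqr ?nnegrE ?(ltW h) // exprMn !sqr_hyp -subr_ge0.
have -> : (a ^+ 2 + b ^+ 2) * (x ^+ 2 + y ^+ 2) - (a * x + b * y) ^+ 2 =
  (a * y - b * x) ^+ 2 by ring.
exact: sqr_ge0.
Qed.

Lemma ler_hypD a b x y : hyp (a + x) (b + y) <= hyp a b + hyp x y.
Proof.
rewrite -ler_sqr ?nnegrE ?addr_ge0 ?hyp_ge0 // sqr_hyp.
have := hyp_dot a b x y.
rewrite (sqrrD (hyp a b)) !sqr_hyp => h.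
have -> : (a + x) ^+ 2 + (b + y) ^+ 2 =
  a ^+ 2 + b ^+ 2 + 2 * (a * x + b * y) + (x ^+ 2 + y ^+ 2) by ring.
by rewrite lerD2r lerD2l -[leRHS]mulr_natl ler_wpM2l.
Qed.

Lemma hypZ c a b : hyp (c * a) (c * b) = `|c| * hyp a b.
Proof.
apply: hyp_eq; first by rewrite mulr_ge0 // hyp_ge0.
by rewrite !exprMn sqr_hyp real_normK ?num_real //; ring.
Qed.

(** The modulus is multiplicative; [hypMc] is the same with one factor
    conjugated. *)
Lemma hypM (a b x y : R) : hyp (a * x - b * y) (a * y + b * x) = hyp a b * hyp x y.
Proof.
apply: hyp_eq; first by rewrite mulr_ge0 // hyp_ge0.
by rewrite [(hyp a b * _) ^+ 2]exprMn !sqr_hyp; ring.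
Qed.

Lemma hypMc (a b x y : R) : hyp (a * x + b * y) (a * y - b * x) = hyp a b * hyp x y.
Proof.
apply: hyp_eq; first by rewrite mulr_ge0 // hyp_ge0.
by rewrite [(hyp a b * _) ^+ 2]exprMn !sqr_hyp; ring.
Qed.

Lemma hypN a b : hyp a (- b) = hyp a b.
Proof. by rewrite /hyp sqrrN. Qed.

Lemma ler_norm_hyp a b : `|a| <= hyp a b /\ `|b| <= hyp a b.
Proof.
split; rewrite -ler_sqr ?nnegrE ?hyp_ge0 // sqr_hyp real_normK ?num_real //.
  by rewrite lerDl sqr_ge0.
by rewrite lerDr sqr_ge0.
Qed.

Lemma ler_hyp_sum (I : Type) (r : seq I) (F G : I -> R) :
  hyp (\sum_(i <- r) F i) (\sum_(i <- r) G i) <= \sum_(i <- r) hyp (F i) (G i).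
Proof.
elim: r => [|i r IH].
  by rewrite !big_nil /hyp expr0n /= addr0 sqrtr0.
by rewrite !big_cons; apply: le_trans (ler_hypD _ _ _ _) _; rewrite lerD2l.
Qed.

Lemma cauchy_schwarz_seq (I : Type) (r : seq I) (w x y : I -> R) :
  (forall i, 0 <= w i) ->
  (\sum_(i <- r) w i * (x i * y i)) ^+ 2 <=
  (\sum_(i <- r) w i * x i ^+ 2) * (\sum_(i <- r) w i * y i ^+ 2).
Proof.
move=> w0; elim: r => [|i r IH].
  by rewrite !big_nil expr0n mul0r.
rewrite !big_cons.
have X0 : 0 <= \sum_(j <- r) w j * x j ^+ 2.
  by apply: sumr_ge0 => j _; rewrite mulr_ge0 ?sqr_ge0.
have Y0 : 0 <= \sum_(j <- r) w j * y j ^+ 2.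
  by apply: sumr_ge0 => j _; rewrite mulr_ge0 ?sqr_ge0.
move: (\sum_(j <- r) _) (\sum_(j <- r) _) (\sum_(j <- r) _) IH X0 Y0 => Y X A IH X0 Y0.
move: (w i) (x i) (y i) (w0 i) => {}w a b {}w0.
have t0 : 0 <= X * b ^+ 2 + Y * a ^+ 2 by apply: addr_ge0; apply: mulr_ge0 => //; exact: sqr_ge0.
have h : 2 * (A * (a * b)) <= X * b ^+ 2 + Y * a ^+ 2.
  case: (leP (2 * (A * (a * b))) 0) => [h|h]; first exact: le_trans t0.
  rewrite -ler_sqr ?nnegrE ?(ltW h) // -subr_ge0.
  have -> : (X * b ^+ 2 + Y * a ^+ 2) ^+ 2 - (2 * (A * (a * b))) ^+ 2 =
    (X * b ^+ 2 - Y * a ^+ 2) ^+ 2 + 4 * ((a * b) ^+ 2 * (X * Y - A ^+ 2)) by ring.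
  rewrite addr_ge0 ?sqr_ge0 //; apply: mulr_ge0 => //.
  by apply: mulr_ge0; rewrite ?sqr_ge0 // subr_ge0.
have hw := ler_wpM2l w0 h.
rewrite -subr_ge0.
have -> : (w * a ^+ 2 + X) * (w * b ^+ 2 + Y) - (w * (a * b) + A) ^+ 2 =
  (w * (X * b ^+ 2 + Y * a ^+ 2) - w * (2 * (A * (a * b)))) + (X * Y - A ^+ 2) by ring.
by rewrite addr_ge0 // subr_ge0.
Qed.

End Pairs.

Section Weighted.
Context (R : realType) (d : nat) (v : 'rV[int]_d -> R) (K W : R).
Hypothesis v_gt0 : forall k, 0 < v k.
Hypothesis v_sum : summable_by (fun k => (v k)^-1) K.
Hypothesis v_conv : forall k, summable_by (fun l => v k / (v l * v (k - l))) W.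
Implicit Types (f g : 'rV[R]_d -> R) (k l : 'rV[int]_d) (r : R).

Let K0 : 0 <= K. Proof. by have := @v_sum [::] isT; rewrite big_nil. Qed.
Let W0 : 0 <= W. Proof. by have := @v_conv 0 [::] isT; rewrite big_nil. Qed.
Let v0 k : 0 <= v k. Proof. exact: ltW. Qed.

(** The modulus of the Fourier coefficient. *)
Definition amp f k : R := hyp (cos_coef f k) (sin_coef f k).

Definition square_summable (x : 'rV[int]_d -> R) r : Prop :=
  summable_by (fun k => v k * x k ^+ 2) (r ^+ 2).

(** With v the square of the Gevrey weight, this is the Gevrey ball. The theory
    below uses a positive v only through the summability of its inverse and the
    bound on v k / (v l * v (k - l)) summed over l. *)
Definition wball r f : Prop :=
  [/\ torus_function f, 0 <= r & square_summable (amp f) r].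

Lemma amp_ge0 f k : 0 <= amp f k. Proof. exact: hyp_ge0. Qed.

Lemma square_summable_le x y r : square_summable y r -> 
  (forall k, 0 <= x k <= y k) -> square_summable x r.
Proof.
move=> hy xy s us; apply: le_trans (hy s us); apply: ler_sum => k _.
rewrite ler_wpM2l // lerXn2r ?nnegrE; have /andP[] := xy k => //.
by move=> h1 h2; exact: le_trans h2.
Qed.

Lemma square_summable_lin (a b r1 r2 : R) x y : 0 <= a -> 0 <= b ->
  0 <= r1 -> 0 <= r2 -> square_summable x r1 -> square_summable y r2 ->
  square_summable (fun k => a * x k + b * y k) (a * r1 + b * r2).
Proof.
move=> a0 b0 r10 r20 hx hy s us.
have -> : \sum_(k <- s) v k * (a * x k + b * y k) ^+ 2 =
    a ^+ 2 * (\sum_(k <- s) v k * x k ^+ 2) +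
    (2 * a * b) * (\sum_(k <- s) v k * (x k * y k)) +
    b ^+ 2 * (\sum_(k <- s) v k * y k ^+ 2).
  by rewrite !mulr_sumr -!big_split /=; apply: eq_bigr => k _; ring.
have -> : (a * r1 + b * r2) ^+ 2 =
  a ^+ 2 * r1 ^+ 2 + (2 * a * b) * (r1 * r2) + b ^+ 2 * r2 ^+ 2 by ring.
have hxs := hx s us; have hys := hy s us.
apply: lerD; last by rewrite ler_wpM2l // sqr_ge0.
apply: lerD; first by rewrite ler_wpM2l // sqr_ge0.
apply: ler_wpM2l; first by rewrite !mulr_ge0.
have r0 : 0 <= r1 * r2 by rewrite mulr_ge0.
apply: (le_trans (ler_norm _)).
rewrite -ler_sqr ?nnegrE // real_normK ?num_real //.
apply: le_trans (cauchy_schwarz_seq _ _ _ v0) _.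
rewrite exprMn; apply: ler_pM => //; apply: sumr_ge0 => k _;
  by rewrite mulr_ge0 ?sqr_ge0.
Qed.

(** Cauchy-Schwarz against the summable weight 1 / v; this is what makes the
    Fourier series of a function in a ball converge absolutely. *)
Lemma square_summable_sum x r : 0 <= r -> (forall k, 0 <= x k) ->
  square_summable x r -> summable_by x (r * Num.sqrt K).
Proof.
move=> r0 x0 hx s us.
rewrite -ler_sqr ?nnegrE ?mulr_ge0 ?sqrtr_ge0 //; last exact: sumr_ge0.
rewrite exprMn sqr_sqrtr //.
have := cauchy_schwarz_seq s x (fun k => (v k)^-1) v0.
rewrite (eq_bigr x) => [h|k _]; last by rewrite mulrCA mulfV ?mulr1 // gt_eqF.
apply: (le_trans h); apply: ler_pM.
- by apply: sumr_ge0 => k _; rewrite mulr_ge0 ?sqr_ge0.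
- by apply: sumr_ge0 => k _; rewrite mulr_ge0 ?sqr_ge0.
- exact: hx.
- apply: le_trans (v_sum us); apply: ler_sum => k _.
  by rewrite expr2 mulrA mulfV ?mul1r // gt_eqF.
Qed.

Lemma wball_cont r f : wball r f -> continuous f. Proof. by case=> -[]. Qed.

Lemma amp_summable r f : wball r f -> summable_by (amp f) (r * Num.sqrt K).
Proof.
move=> [_ r0 hf]; apply: square_summable_sum => // k; exact: amp_ge0.
Qed.

Lemma wball_inversion r f : wball r f ->
  ucvg (trig_sum (cos_coef f) (sin_coef f)) f.
Proof.
move=> hf; have two0 : 0 <= 2 :> R by [].
apply: (fourier_inversion _ (summable_byZ two0 (amp_summable hf))).
  by case: hf.
move=> l; have [h1 h2] := ler_norm_hyp (cos_coef f l) (sin_coef f l).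
by rewrite mulr_natl mulr2n lerD.
Qed.

Definition sup_const : R := (2 * pi) ^- d * Num.sqrt K.

Lemma sup_const_ge0 : 0 <= sup_const.
Proof.
by rewrite mulr_ge0 ?sqrtr_ge0 // invr_ge0 exprn_ge0 // ltW // twopi_gt0.
Qed.

Lemma wball_sup r f x : wball r f -> `|f x| <= sup_const * r.
Proof.
move=> hf; have p0 : 0 < (2 * pi) ^- d :> R by rewrite invr_gt0 exprn_gt0 // twopi_gt0.
have cS : (fun N => `|trig_sum (cos_coef f) (sin_coef f) N x|) @ \oo --> `|f x|.
  by apply: cvg_norm; apply: (ucvg_cvg (wball_inversion hf)).
have := limr_le (cvgP _ cS); rewrite (cvg_lim _ cS) //; apply.
near=> N; rewrite /trig_sum (le_trans (ler_norm_sum _ _ _)) //.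
rewrite /sup_const -mulrA.
apply: (@le_trans _ _ (\sum_(l <- firsts _ N) (2 * pi) ^- d * amp f l)).
  apply: ler_sum => l _; rewrite normrM gtr0_norm //; apply: ler_wpM2l; first exact: ltW.
  rewrite ler_norml; apply/andP; split; last first.
    apply: (le_trans (hyp_dot _ _ _ _)).
    by rewrite /hyp cos2Dsin2 sqrtr1 mulr1.
  rewrite lerNl opprD -!mulrN.
  apply: (le_trans (hyp_dot _ _ _ _)).
  by rewrite /hyp !sqrrN cos2Dsin2 sqrtr1 mulr1.
rewrite -mulr_sumr; apply: ler_wpM2l; first exact: ltW.
by rewrite mulrC; apply: (amp_summable hf); exact: firsts_uniq.
Unshelve. all: by end_near.
Qed.

Lemma wball_lin (a b r1 r2 : R) f g : wball r1 f -> wball r2 g ->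
  wball (`|a| * r1 + `|b| * r2) (fun x => a * f x + b * g x).
Proof.
move=> [tf r10 hf] [tg r20 hg]; split.
- split; first exact: continuous_lin tf.1 tg.1.
  by move=> x k; rewrite tf.2 tg.2.
- by rewrite addr_ge0 // mulr_ge0.
- apply: (square_summable_le (square_summable_lin (normr_ge0 a) (normr_ge0 b) r10 r20 hf hg)).
  move=> k; rewrite amp_ge0 /amp cos_coef_lin ?sin_coef_lin //;
    try by [case: tf|case: tg].
  by rewrite (le_trans (ler_hypD _ _ _ _)) // !hypZ.
Qed.

Lemma wball_le r1 r2 f : r1 <= r2 -> wball r1 f -> wball r2 f.
Proof.
move=> r12 [tf r0 hf]; split=> //; first exact: le_trans r12.
move=> s us; apply: le_trans (hf s us) _.
by rewrite lerXn2r ?nnegrE // (le_trans r0).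
Qed.

(** Only finitely many coefficients are tested at a time, and each depends
    continuously on the function for uniform convergence. *)
Lemma wball_closed r f (u : nat -> 'rV[R]_d -> R) : (forall n, wball r (u n)) ->
  ucvg u f -> wball r f.
Proof.
move=> hu uf; have cu n : continuous (u n) := wball_cont (hu n).
split.
- by apply: ucvg_torus uf => n; have [] := hu n.
- by have [] := hu 0%N.
- move=> s us.
  have cS : (fun n => \sum_(k <- s) v k * amp (u n) k ^+ 2) @ \oo -->
      \sum_(k <- s) v k * amp f k ^+ 2.
    elim: s {us} => [|k s IH].
      rewrite big_nil; under eq_fun do rewrite big_nil; exact: cvg_cst.
    rewrite big_cons; under eq_fun do rewrite big_cons.
    apply: cvgD => //; apply: cvgM; first exact: cvg_cst.
    have [h1 h2] := ucvg_coef k cu uf.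
    rewrite /amp sqr_hyp; under eq_fun do rewrite sqr_hyp.
    by apply: cvgD; rewrite expr2; under eq_fun do rewrite expr2; exact: cvgM.
  have := limr_le (cvgP _ cS); rewrite (cvg_lim _ cS) //; apply.
  by near=> n; have [_ _] := hu n; apply.
Unshelve. all: by end_near.
Qed.

End Weighted.

Section WeightedAlgebra.
Context (R : realType) (d : nat) (v : 'rV[int]_d -> R) (K W : R).
Hypothesis v_gt0 : forall k, 0 < v k.
Hypothesis v_sum : summable_by (fun k => (v k)^-1) K.
Hypothesis v_conv : forall k, summable_by (fun l => v k / (v l * v (k - l))) W.
Implicit Types (f g : 'rV[R]_d -> R) (k l : 'rV[int]_d) (r : R).

Let W0 : 0 <= W. Proof. by have := @v_conv 0 [::] isT; rewrite big_nil. Qed.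
Let v0 k : 0 <= v k. Proof. exact: ltW. Qed.

(** Cauchy-Schwarz in l with weight v l * v (k - l) separates the hypothesis on
    v from a double sum that factors. *)
Lemma convolution_bound (x y : 'rV[int]_d -> R) r1 r2 (L s : seq 'rV[int]_d) :
  square_summable v x r1 -> square_summable v y r2 -> uniq L -> uniq s ->
  \sum_(k <- s) v k * (\sum_(l <- L) x l * y (k - l)) ^+ 2 <=
  W * (r1 ^+ 2 * r2 ^+ 2).
Proof.
move=> hx hy uL us.
have xx l : 0 <= v l * x l ^+ 2 by rewrite mulr_ge0 ?sqr_ge0.
have yy l : 0 <= v l * y l ^+ 2 by rewrite mulr_ge0 ?sqr_ge0.
have pointwise k : v k * (\sum_(l <- L) x l * y (k - l)) ^+ 2 <=
    W * \sum_(l <- L) (v l * x l ^+ 2) * (v (k - l) * y (k - l) ^+ 2).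
  have w0 l : 0 < v l * v (k - l) by rewrite mulr_gt0.
  have := cauchy_schwarz_seq L (fun l => x l * y (k - l))
    (fun l => (v l * v (k - l))^-1) (fun l => ltW (w0 l)).
  rewrite (eq_bigr (fun l => x l * y (k - l))) => [h|l _]; last first.
    by rewrite mulrCA mulfV ?mulr1 // gt_eqF.
  apply: (le_trans (ler_wpM2l (v0 k) h)).
  rewrite mulrCA mulrC; apply: ler_pM.
  - by apply: mulr_ge0 => //; apply: sumr_ge0 => l _; rewrite mulr_ge0 ?sqr_ge0 // ltW.
  - by apply: sumr_ge0 => l _; rewrite mulr_ge0 ?sqr_ge0 // ltW.
  - apply: le_trans (v_conv k uL); rewrite mulr_sumr; apply: ler_sum => l _.
    by rewrite [_^-1 ^+ 2]expr2 [X in _ * X <= _]mulrA mulfV ?mul1r // gt_eqF.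
  - by apply: ler_sum => l _; rewrite exprMn mulrACA.
apply: (le_trans (ler_sum _ (fun k _ => pointwise k))).
rewrite -mulr_sumr; apply: ler_wpM2l => //.
rewrite exchange_big /=.
apply: (@le_trans _ _ (\sum_(l <- L) (v l * x l ^+ 2) * r2 ^+ 2)).
  apply: ler_sum => l _; rewrite -mulr_sumr; apply: ler_wpM2l => //.
  have := hy [seq k - l | k <- s]; rewrite big_map; apply.
  by rewrite map_inj_uniq //; exact: addIr.
by rewrite -mulr_suml ler_wpM2r ?sqr_ge0 // hx.
Qed.

(** Product-to-sum formulas: multiplying by a wave of frequency l shifts the
    spectrum of g by l and by - l. *)
Lemma amp_trig_term_mul (c s : 'rV[int]_d -> R) l g k : continuous g ->
  amp (fun x => trig_term c s l x * g x) k <=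
  (2 * pi) ^- d * 2^-1 * (hyp (c l) (s l) * (amp g (k - l) + amp g (k + l))).
Proof.
move=> cg; have p0 := twopiX_neq0 R d.
have cc m : continuous (fun x => g x * cos (phase m x)).
  by apply: continuous_mul => //; exact: continuous_cos_phase.
have cs m : continuous (fun x => g x * sin (phase m x)).
  by apply: continuous_mul => //; exact: continuous_sin_phase.
pose q : R := (2 * pi) ^- d * 2^-1.
have q0 : 0 <= q.
  by rewrite /q mulr_ge0 ?invr_ge0 ?exprn_ge0 // ltW ?twopi_gt0.
have EC : cos_coef (fun x => trig_term c s l x * g x) k =
    q * (c l * cos_coef g (k - l) - s l * sin_coef g (k - l)) +
    q * (c l * cos_coef g (k + l) + s l * sin_coef g (k + l)).
  transitivity (torus_integral (fun x : 'rV[R]_d =>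
    q * (c l * (g x * cos (phase (k - l) x)) + (- s l) * (g x * sin (phase (k - l) x))) +
    q * (c l * (g x * cos (phase (k + l) x)) + s l * (g x * sin (phase (k + l) x))))).
    congr torus_integral; apply/funext => x.
    by rewrite !phaseD phaseN cosB sinB cosD sinD /trig_term /q; field.
  rewrite torus_integral_lin; try exact: continuous_lin.
  by rewrite !torus_integral_lin // /cos_coef /sin_coef; ring.
have ES : sin_coef (fun x => trig_term c s l x * g x) k =
    q * (c l * sin_coef g (k - l) + s l * cos_coef g (k - l)) +
    q * (c l * sin_coef g (k + l) - s l * cos_coef g (k + l)).
  transitivity (torus_integral (fun x : 'rV[R]_d =>
    q * (c l * (g x * sin (phase (k - l) x)) + s l * (g x * cos (phase (k - l) x))) +
    q * (c l * (g x * sin (phase (k + l) x)) + (- s l) * (g x * cos (phase (k + l) x))))).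
    congr torus_integral; apply/funext => x.
    by rewrite !phaseD phaseN cosB sinB cosD sinD /trig_term /q; field.
  rewrite torus_integral_lin; try exact: continuous_lin.
  by rewrite !torus_integral_lin // /cos_coef /sin_coef; ring.
rewrite [amp _ k]/amp EC ES; apply: (le_trans (ler_hypD _ _ _ _)).
by rewrite !hypZ (ger0_norm q0) hypM hypMc -/q -!mulrDr.
Qed.

Definition mul_const : R := (2 * pi) ^- d * Num.sqrt W.

Lemma mul_const_ge0 : 0 <= mul_const.
Proof. by rewrite mulr_ge0 ?sqrtr_ge0 // invr_ge0 exprn_ge0 // ltW // twopi_gt0. Qed.

Lemma ampN f k : continuous f -> amp f (- k) = amp f k.
Proof. by move=> cf; rewrite /amp cos_coefN sin_coefN // hypN. Qed.

Lemma torus_mul f g : torus_function f -> torus_function g ->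
  torus_function (fun x => f x * g x).
Proof.
move=> [cf pf] [cg pg]; split; first exact: continuous_mul.
by move=> x k; rewrite pf pg.
Qed.

(** For a trigonometric polynomial the coefficients of the product are finite
    convolutions, up to the reflection of frequencies that comes with the
    product-to-sum formulas. *)
Lemma wball_trig_mul f g r1 r2 N : wball v r1 f -> wball v r2 g ->
  wball v (mul_const * (r1 * r2))
    (fun x => trig_sum (cos_coef f) (sin_coef f) N x * g x).
Proof.
move=> [tf r10 hf] [tg r20 hg].
have P0 : 0 <= (2 * pi) ^- d :> R by rewrite invr_ge0 exprn_ge0 // ltW // twopi_gt0.
split.
- by apply: torus_mul => //; exact: trig_sum_torus.
- by rewrite !mulr_ge0 // ?mul_const_ge0.
- move=> s us; set L := firsts 'rV[int]_d N.
  have uL : uniq L := firsts_uniq _ _.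
  (* B is the sum over l of amp f l * amp g (k + l), reindexed by l -> - l. *)
  pose A k := \sum_(l <- L) amp f l * amp g (k - l).
  pose B k := \sum_(l <- [seq - l | l <- L]) amp f l * amp g (k - l).
  have bound k : amp (fun x => trig_sum (cos_coef f) (sin_coef f) N x * g x) k <=
      (2 * pi) ^- d * 2^-1 * (A k + B k).
    have -> : (fun x => trig_sum (cos_coef f) (sin_coef f) N x * g x) =
        (fun x => \sum_(l <- L) trig_term (cos_coef f) (sin_coef f) l x * g x).
      by apply/funext => x; rewrite mulr_suml.
    have ct l : continuous (fun x => trig_term (cos_coef f) (sin_coef f) l x * g x).
      by apply: continuous_mul tg.1; exact: (trig_term_torus _ _ _).1.
    rewrite [amp _ k]/amp; have [-> ->] := coef_sum L k ct.
    apply: (le_trans (ler_hyp_sum _ _ _)).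
    apply: (le_trans (ler_sum _ (fun l _ => amp_trig_term_mul _ _ l k tg.1))).
    rewrite -mulr_sumr; apply: ler_wpM2l; first by rewrite mulr_ge0.
    rewrite /A /B big_map -big_split /=; apply: ler_sum => l _.
    by rewrite mulrDr opprK ampN //; case: tf.
  have hA := convolution_bound hf hg uL us.
  have uNL : uniq [seq - l | l <- L] by rewrite map_inj_uniq //; exact: oppr_inj.
  have hB := convolution_bound hf hg uNL us.
  apply: (@le_trans _ _ (((2 * pi) ^- d) ^+ 2 * 2^-1 *
    (\sum_(k <- s) v k * A k ^+ 2 + \sum_(k <- s) v k * B k ^+ 2))).
    rewrite -big_split mulr_sumr; apply: ler_sum => k _ /=.
    rewrite -mulrDr [leRHS]mulrCA; apply: ler_wpM2l => //.
    apply: (@le_trans _ _ (((2 * pi) ^- d * 2^-1 * (A k + B k)) ^+ 2)).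
      rewrite lerXn2r ?nnegrE ?amp_ge0 //.
      exact: le_trans (amp_ge0 _ _) (bound k).
    rewrite -subr_ge0; set p := (2 * pi) ^- d.
    have -> : p ^+ 2 * 2^-1 * (A k ^+ 2 + B k ^+ 2) - (p * 2^-1 * (A k + B k)) ^+ 2 =
      (p * 2^-1 * (A k - B k)) ^+ 2 by field.
    exact: sqr_ge0.
  have -> : (mul_const * (r1 * r2)) ^+ 2 = ((2 * pi) ^- d) ^+ 2 * 2^-1 *
      (W * (r1 ^+ 2 * r2 ^+ 2) + W * (r1 ^+ 2 * r2 ^+ 2)).
    by rewrite /mul_const; set p := (2 * pi) ^- d; rewrite !exprMn sqr_sqrtr //; field.
  by apply: ler_wpM2l; [rewrite mulr_ge0 ?sqr_ge0|exact: lerD].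
Qed.

(** The Fourier sums of f converge to f uniformly and g is bounded, so the
    polynomial case passes to the limit in a closed ball. *)
Lemma wball_mul f g r1 r2 : wball v r1 f -> wball v r2 g ->
  wball v (mul_const * (r1 * r2)) (fun x => f x * g x).
Proof.
move=> hf hg.
apply: (wball_closed (u := fun N x => trig_sum (cos_coef f) (sin_coef f) N x * g x)).
  by move=> N; exact: wball_trig_mul.
move=> e e0; pose M : R := sup_const d K * r2 + 1.
have M0 : 0 < M.
  by rewrite ltr_wpDl // mulr_ge0 ?sup_const_ge0 //; case: hg.
have [|N hN] := wball_inversion v_gt0 v_sum hf (e := e / M); first by rewrite divr_gt0.
exists N => n Nn x; rewrite -mulrBl normrM -(divfK (lt0r_neq0 M0) e).
apply: ler_pM => //; first exact: hN.
apply: (le_trans (wball_sup v_gt0 v_sum x hg)).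
by rewrite /M lerDl.
Qed.

Lemma wball_multiplier (m : 'rV[int]_d -> R) (M : R) f r :
  0 <= M -> (forall k, m (- k) = m k) -> (forall k, `|m k| <= M) -> wball v r f ->
  exists u, [/\ wball v (M * r) u, forall k, cos_coef u k = m k * cos_coef f k &
    forall k, sin_coef u k = m k * sin_coef f k].
Proof.
move=> M0 em mM hf; have [tf r0 sf] := hf.
have M20 : 0 <= 2 * M by rewrite mulr_ge0.
have [||l|u [tu _ cu su]] := fourier_synthesis (c := fun k => m k * cos_coef f k)
   (s := fun k => m k * sin_coef f k) _ _
   (summable_byZ M20 (amp_summable v_gt0 v_sum hf)).
- by move=> l; rewrite em cos_coefN.
- by move=> l; rewrite em sin_coefN ?mulrN //; case: tf.
- rewrite !normrM -mulrDr; have [h1 h2] := ler_norm_hyp (cos_coef f l) (sin_coef f l).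
  have -> : 2 * M * amp f l = M * (amp f l + amp f l) by ring.
  by apply: ler_pM; rewrite ?addr_ge0 ?lerD.
exists u; split=> //; split=> //; first by rewrite mulr_ge0.
move=> s us; rewrite exprMn.
apply: (@le_trans _ _ (M ^+ 2 * \sum_(k <- s) v k * amp f k ^+ 2)); last first.
  by rewrite ler_wpM2l ?sqr_ge0 ?sf.
rewrite mulr_sumr; apply: ler_sum => k _; rewrite [leRHS]mulrCA; apply: ler_wpM2l => //.
rewrite /amp cu su hypZ exprMn; apply: ler_wpM2r; first exact: sqr_ge0.
by rewrite lerXn2r ?nnegrE.
Qed.

Lemma wballB f g r1 r2 : wball v r1 f -> wball v r2 g ->
  wball v (r1 + r2) (fun x => f x - g x).
Proof.
move=> hf hg; have := wball_lin v_gt0 1 (-1) hf hg.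
rewrite normrN normr1 !mul1r (_ : (fun x => _) = (fun x => f x - g x)) //.
by apply/funext => x; rewrite mul1r mulN1r.
Qed.

Lemma wballD f g r1 r2 : wball v r1 f -> wball v r2 g ->
  wball v (r1 + r2) (fun x => f x + g x).
Proof.
move=> hf hg; have := wball_lin v_gt0 1 1 hf hg.
rewrite normr1 !mul1r (_ : (fun x => _) = (fun x => f x + g x)) //.
by apply/funext => x; rewrite !mul1r.
Qed.

Lemma wballZ (a : R) f r : wball v r f -> wball v (`|a| * r) (fun x => a * f x).
Proof.
move=> hf; have := wball_lin v_gt0 a 0 hf hf.
rewrite normr0 mul0r addr0 (_ : (fun x => _) = (fun x => a * f x)) //.
by apply/funext => x; rewrite mul0r addr0.
Qed.

(** The Gevrey norm dominates the uniform norm, so the increments are bounded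
    uniformly by a geometric series. *)
Lemma wball_complete (u : nat -> 'rV[R]_d -> R) r :
  (forall n, wball v (r * 2^-1 ^+ n) (fun x => u n.+1 x - u n x)) ->
  exists f, ucvg u f.
Proof.
move=> hu; have r0 : 0 <= r by have [_ + _] := hu 0%N; rewrite expr0 mulr1.
pose C := sup_const d K * r.
have C0 : 0 <= C by rewrite mulr_ge0 ?sup_const_ge0.
have geo := summable_byZ C0 (geometric_summable R).
have [n x|g hg] := weierstrass_M (F := fun n x => u n.+1 x - u n x) geo.
  apply: (le_trans (wball_sup v_gt0 v_sum x (hu n))).
  by rewrite /C mulrA.
exists (fun x => g x + u 0%N x) => e e0; have [N hN] := hg e e0.
exists N => n Nn x; have := hN n Nn x.
have -> : \sum_(j <- firsts nat n) (u j.+1 x - u j x) = u n x - u 0%N x.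
  rewrite firsts_nat -[n in iota 0 n]subn0 -/(index_iota 0 n).
  by rewrite (telescope_sumr (fun j => u j x)).
by rewrite opprB addrA.
Qed.

End WeightedAlgebra.

(** * The fixed point equation in an abstract weighted space *)

Section PowerSeries.
Context (R : realType) (a : R^nat) (M B : R).
Hypothesis a_bound : forall n, `|a n| <= M * B ^+ n.
Hypothesis B_ge0 : 0 <= B.

Let M0 : 0 <= M.
Proof. by have := a_bound 0; rewrite expr0 mulr1; exact: le_trans. Qed.

Lemma pseries_ucvg (T : Type) (u : T -> R) : (forall x, B * `|u x| <= 2^-1) ->
  ucvg (fun N x => pseries a (u x) N) (fun x => pseries_sum a (u x)) /\
  forall x, cvgn (pseries a (u x)).
Proof.
move=> uB.
have [n x|f hf] := weierstrass_M (F := fun n x => a n * u x ^+ n)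
    (summable_byZ M0 (geometric_summable R)).
  rewrite normrM normrX; apply: (@le_trans _ _ (M * B ^+ n * `|u x| ^+ n)).
    by apply: ler_wpM2r => //; rewrite exprn_ge0.
  rewrite -mulrA -exprMn; apply: ler_wpM2l => //.
  by rewrite lerXn2r ?nnegrE ?mulr_ge0 ?invr_ge0.
have E N x : \sum_(n <- firsts nat N) a n * u x ^+ n = pseries a (u x) N.
  by rewrite firsts_nat /pseries /series /= /index_iota subn0.
have cv x : (fun N => pseries a (u x) N) @ \oo --> f x.
  by have := ucvg_cvg (x := x) hf; under eq_fun do rewrite E.
split=> [e e0|x]; last exact: cvgP (cv x).
have [N hN] := hf e e0; exists N => n Nn x.
have := hN n Nn x; rewrite E /pseries_sum.
by rewrite (cvg_lim _ (cv x)).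
Qed.

(** The point z lies slightly beyond |y| and still satisfies B * z <= 1 / 2,
    so that the series converges there. *)
Lemma lt_cvg_radius (y : R) : B * `|y| <= 4^-1 -> (`|y|%:E < cvg_radius a)%E.
Proof.
move=> hy; pose z : R := `|y| + (4 * (B + 1))^-1.
have B1 : 0 < B + 1 by rewrite ltr_wpDl.
have z0 : 0 < (4 * (B + 1))^-1 :> R by rewrite invr_gt0 mulr_gt0.
have zy : `|y| < z by rewrite ltrDl.
have zp : 0 < z := le_lt_trans (normr_ge0 y) zy.
apply: (@lt_le_trans _ _ `|z|%:E).
  by rewrite lte_fin (gtr0_norm zp).
apply: ereal_sup_ubound; exists z => //=.
suff zB : B * `|z| <= 2^-1 by exact: (@pseries_ucvg unit (fun=> z) (fun=> zB)).2 tt.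
rewrite (gtr0_norm zp) /z mulrDr.
rewrite (_ : 2^-1 = 4^-1 + 4^-1); last by field.
apply: lerD => //; rewrite invfM mulrCA -[leRHS]mulr1; apply: ler_wpM2l => //.
by rewrite ler_pdivrMr // mul1r lerDl.
Qed.

End PowerSeries.

(** The terms of the series at a nonzero point of convergence are bounded. *)
Lemma cvg_radius_bound (R : realType) (a : R^nat) : (0 < cvg_radius a)%E ->
  exists M B : R, 0 <= B /\ forall n, `|a n| <= M * B ^+ n.
Proof.
move=> /ereal_sup_gt[_ [y /= cy <-]]; rewrite lte_fin normr_gt0 => y0.
have c0 : (fun n => a n * y ^+ n) @ \oo --> 0 by apply: cvg_series_cvg_0.
have /cvg_seq_bounded[M [_ hM]] : cvgn (fun n => a n * y ^+ n) by exact: cvgP c0.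
exists (`|M| + 1), `|y|^-1; split=> [|n]; first by rewrite invr_ge0.
have /= := hM (`|M| + 1) _ n I; rewrite (le_lt_trans (ler_norm M)) ?ltrDl // => /(_ isT).
rewrite normrM normrX exprVn ler_pdivlMr // exprn_gt0 //.
by rewrite normr_gt0.
Qed.

Section FixedPoint.
Context (R : realType) (d : nat) (v : 'rV[int]_d -> R) (K W : R).
Hypothesis v_gt0 : forall k, 0 < v k.
Hypothesis v_sum : summable_by (fun k => (v k)^-1) K.
Hypothesis v_conv : forall k, summable_by (fun l => v k / (v l * v (k - l))) W.
Context (a : R^nat) (M B : R).
Hypothesis a_bound : forall n, `|a n| <= M * B ^+ n.
Hypothesis B_ge0 : 0 <= B.
Hypothesis a0 : a 0%N = 0.
Hypothesis a1 : a 1%N = 0.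
Implicit Types (f g u w q rho : 'rV[R]_d -> R) (r : R).

Let M0 : 0 <= M.
Proof. by have := a_bound 0; rewrite expr0 mulr1; exact: le_trans. Qed.

Let kappa := mul_const d W.
Let kappa0 : 0 <= kappa. Proof. exact: mul_const_ge0. Qed.
Let C := sup_const d K.
Let C0 : 0 <= C. Proof. exact: sup_const_ge0. Qed.

Lemma wball_eq f g r : (forall x, f x = g x) -> wball v r f -> wball v r g.
Proof. by move=> fg; have -> : f = g by exact/funext. Qed.

Lemma wballC f g r : wball v r (fun x => f x - g x) -> wball v r (fun x => g x - f x).
Proof.
move=> /(wballZ v_gt0 (-1)); rewrite normrN normr1 mul1r.
by apply: wball_eq => x; rewrite mulN1r opprB.
Qed.

Lemma wball0 r f : 0 <= r -> wball v r f -> wball v 0 (fun=> 0).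
Proof.
move=> r0 /(wballZ v_gt0 0); rewrite normr0 mul0r.
by apply: wball_eq => x; rewrite mul0r.
Qed.

Lemma wballX r u n : wball v r u ->
  wball v ((kappa * r) ^+ n * r) (fun x => u x ^+ n.+1).
Proof.
move=> hu; elim: n => [|n IH]; first by rewrite expr0 mul1r; exact: hu.
have := wball_mul v_gt0 v_sum v_conv hu IH; rewrite -/kappa.
rewrite (_ : kappa * (r * _) = (kappa * r) ^+ n.+1 * r); last by rewrite exprS; ring.
by apply: wball_eq => x; rewrite [RHS]exprS.
Qed.

(** Induction on u^(n+2) - w^(n+2) = u (u^(n+1) - w^(n+1)) + (u - w) w^(n+1). *)
Lemma wballXB r dl u w n : wball v r u -> wball v r w ->
  wball v dl (fun x => u x - w x) ->
  wball v (n.+1%:R * (kappa * r) ^+ n * dl) (fun x => u x ^+ n.+1 - w x ^+ n.+1).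
Proof.
move=> hu hw huw; elim: n => [|n IH].
  by rewrite expr0 !mul1r; exact: huw.
have h1 := wball_mul v_gt0 v_sum v_conv hu IH.
have h2 := wball_mul v_gt0 v_sum v_conv huw (wballX n hw).
have := wballD v_gt0 h1 h2; rewrite -/kappa.
rewrite (_ : _ + _ = n.+2%:R * (kappa * r) ^+ n.+1 * dl); last first.
  by rewrite exprS -[n.+2]addn1 natrD; ring.
by apply: wball_eq => x; rewrite !exprS; ring.
Qed.

(** The terms of degree 0 and 1 are absent, so the Lipschitz constant on a ball
    is proportional to its radius. *)
Lemma wball_pseries_lipschitz r dl u w : 4 * B * kappa * r <= 1 ->
  B * (C * r) <= 2^-1 -> wball v r u -> wball v r w ->
  wball v dl (fun x => u x - w x) ->
  wball v (8 * M * B ^+ 2 * kappa * r * dl)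
    (fun x => pseries_sum a (u x) - pseries_sum a (w x)).
Proof.
move=> hr1 hr2 hu hw huw.
have r0 : 0 <= r by case: hu.
have dl0 : 0 <= dl by case: huw.
pose A : R := 4 * M * B ^+ 2 * kappa * r.
have A0 : 0 <= A.
  by apply: mulr_ge0 => //; apply: mulr_ge0 => //; apply: mulr_ge0; rewrite ?sqr_ge0 ?mulr_ge0.
have small f : wball v r f -> forall x, B * `|f x| <= 2^-1.
  move=> hf x; apply: le_trans hr2; apply: ler_wpM2l => //.
  exact: (wball_sup v_gt0 v_sum x hf).
have [cu _] := pseries_ucvg a_bound B_ge0 (small u hu).
have [cw _] := pseries_ucvg a_bound B_ge0 (small w hw).
(* Since N + 2 <= 2 ^ (N + 2) and 4 B kappa r <= 1, the increment of degree
   N + 2 is at most A 2^-N dl; the partial sums of this geometric series appear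
   below. *)
have key N : wball v (A * (2 - 2 * 2^-1 ^+ N) * dl)
    (fun x => pseries a (u x) N.+2 - pseries a (w x) N.+2).
  elim: N => [|N IH].
    rewrite expr0 (_ : _ * dl = 0); last by ring.
    apply: wball_eq (wball0 r0 hu) => x.
    by rewrite /pseries /series /= !big_nat_recr //= !big_geq // a0 a1; ring.
  have h1 := wballZ v_gt0 (a N.+2) (wballXB N.+1 hu hw huw).
  have := wballD v_gt0 IH h1.
  move=> /(wball_le (r2 := A * (2 - 2 * 2^-1 ^+ N.+1) * dl)) h.
  apply: wball_eq (h _) => [x|].
    rewrite /pseries /series /= [in RHS]big_nat_recr //= [X in _ = _ - X]big_nat_recr //=.
    by ring.
  have -> : A * (2 - 2 * 2^-1 ^+ N.+1) * dl =
      A * (2 - 2 * 2^-1 ^+ N) * dl + A * 2^-1 ^+ N * dl.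
    by rewrite exprS; field.
  rewrite lerD2l mulrA; apply: ler_wpM2r => //.
  have pw : (N.+2%:R : R) <= 2 ^+ N.+2.
    by rewrite -natrX ler_nat ltnW // ltn_expl.
  have x0 : 0 <= kappa * r by rewrite mulr_ge0.
  apply: (@le_trans _ _ (M * B ^+ N.+2 * (2 ^+ N.+2 * (kappa * r) ^+ N.+1))).
    apply: ler_pM => //; first by rewrite mulr_ge0 // exprn_ge0.
    by apply: ler_wpM2r => //; rewrite exprn_ge0.
  have -> : M * B ^+ N.+2 * (2 ^+ N.+2 * (kappa * r) ^+ N.+1) =
      A * (2 * B * kappa * r) ^+ N.
    by rewrite /A; move: kappa => k1; rewrite !exprMn !exprS; ring.
  apply: ler_wpM2l => //.
  have t0 : 0 <= 2 * B * kappa * r by do 3?[apply: mulr_ge0 => //].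
  rewrite lerXn2r ?nnegrE ?invr_ge0 //.
  have E : 4 * B * kappa * r = 2 * (2 * B * kappa * r) by ring.
  by rewrite E in hr1; rewrite -[2^-1]mul1r ler_pdivlMr // mulrC.
apply: (wball_closed (u := fun N x => pseries a (u x) N.+2 - pseries a (w x) N.+2)).
  move=> N; apply: wball_le (key N); apply: ler_wpM2r => //.
  have -> : 8 * M * B ^+ 2 * kappa * r = A * 2 by rewrite /A; ring.
  by apply: ler_wpM2l => //; rewrite gerBl mulr_ge0 // exprn_ge0 // invr_ge0.
move=> e e0; have e20 : 0 < e / 2 by rewrite divr_gt0.
have [N1 h1] := cu _ e20; have [N2 h2] := cw _ e20.
exists (maxn N1 N2) => n hn x.
have n1 : (N1 <= n.+2)%N by rewrite (leq_trans (leq_maxl N1 N2)) // (leq_trans hn) // -addn2 leq_addr.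
have n2 : (N2 <= n.+2)%N by rewrite (leq_trans (leq_maxr N1 N2)) // (leq_trans hn) // -addn2 leq_addr.
have := h1 _ n1 x; have := h2 _ n2 x.
move: (pseries_sum a (u x)) (pseries a (u x) _) (pseries_sum a (w x)) (pseries a (w x) _).
move=> p1 p2 p3 p4 i1 i2.
have -> : p1 - p3 - (p2 - p4) = (p1 - p2) - (p3 - p4) by ring.
rewrite (le_trans (ler_normB _ _)) // (_ : e = e / 2 + e / 2); last by field.
exact: lerD.
Qed.

(** The criterion by which both the existence and the uniqueness of the fixed
    point are concluded. *)
Lemma wball_small r f : (forall n, wball v (r * 2^-1 ^+ n) f) -> forall x, f x = 0.
Proof.
move=> hf x.
have bound n : `|f x| <= C * r * 2^-1 ^+ n.
  by rewrite -mulrA; exact: (wball_sup v_gt0 v_sum x (hf n)).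
have c0 : (fun n => C * r * 2^-1 ^+ n) @ \oo --> C * r * 0.
  apply: cvgM; first exact: cvg_cst.
  by apply: cvg_expr; rewrite ger0_norm ?invr_ge0 // invf_lt1 // ltr1n.
have := limr_ge (cvgP _ c0); rewrite (cvg_lim _ c0) // mulr0 => h.
apply/eqP; rewrite -normr_le0; apply: h; exact: nearW.
Qed.

Context (m : 'rV[int]_d -> R) (c : R).
Hypothesis m_even : forall k, m (- k) = m k.
Hypothesis m_bound : forall k, `|m k| <= c.

Let c0 : 0 <= c. Proof. exact: le_trans (normr_ge0 _) (m_bound 0). Qed.

Definition multiplied rho u : Prop := torus_function u /\
  forall k, cos_coef u k = m k * cos_coef rho k /\
            sin_coef u k = m k * sin_coef rho k.

Lemma multiplied_unique rho u w : multiplied rho u -> multiplied rho w -> u = w.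
Proof.
move=> [tu hu] [tw hw]; apply: torus_fourier_unique => // k.
by have [-> ->] := hu k; have [-> ->] := hw k.
Qed.

Lemma multiplied_exists r rho : wball v r rho -> exists u, multiplied rho u.
Proof.
move=> /(wball_multiplier v_gt0 v_sum c0 m_even m_bound)[u [[tu _ _] hc hs]].
by exists u; split.
Qed.

Lemma multiplied_wball r rho u : multiplied rho u -> wball v r rho ->
  wball v (c * r) u.
Proof.
move=> hu hr; have [w [hw hc hs]] := wball_multiplier v_gt0 v_sum c0 m_even m_bound hr.
rewrite (multiplied_unique hu (w := w)) //.
by split=> //; case: hw.
Qed.

Lemma multipliedB rho1 rho2 u1 u2 : continuous rho1 -> continuous rho2 ->
  multiplied rho1 u1 -> multiplied rho2 u2 ->
  multiplied (fun x => rho1 x - rho2 x) (fun x => u1 x - u2 x).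
Proof.
move=> cr1 cr2 [t1 h1] [t2 h2].
have E f g : (fun x => f x - g x) = (fun x => 1 * f x + (-1) * g x).
  by apply/funext => x; rewrite mul1r mulN1r.
split.
  split; first by rewrite E; exact: continuous_lin t1.1 t2.1.
  by move=> x k; rewrite t1.2 t2.2.
move=> k; rewrite !E !cos_coef_lin ?sin_coef_lin //; try by [case: t1|case: t2].
by have [-> ->] := h1 k; have [-> ->] := h2 k; split; ring.
Qed.

(** The radius 2 eps is such that the solution ball is mapped into itself when
    the nonlinear map halves distances: q uses up eps, and the nonlinear part,
    which vanishes at 0, at most half of 2 eps. *)
Section Contraction.
Context (eps : R) (q : 'rV[R]_d -> R).
Hypothesis eps_gt0 : 0 < eps.
Hypothesis eps_small1 : 4 * B * kappa * (c * (2 * eps)) <= 1.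
Hypothesis eps_small2 : B * (C * (c * (2 * eps))) <= 4^-1.
Hypothesis eps_small3 : 8 * M * B ^+ 2 * kappa * (c * (2 * eps)) * c <= 2^-1.
Hypothesis q_ball : wball v eps q.

Lemma nonlinear_contraction rho1 rho2 u1 u2 dl :
  wball v (2 * eps) rho1 -> wball v (2 * eps) rho2 ->
  multiplied rho1 u1 -> multiplied rho2 u2 ->
  wball v dl (fun x => rho1 x - rho2 x) ->
  wball v (dl * 2^-1)
    (fun x => (q x - pseries_sum a (u1 x)) - (q x - pseries_sum a (u2 x))).
Proof.
move=> h1 h2 m1 m2 h12.
have w1 := multiplied_wball m1 h1; have w2 := multiplied_wball m2 h2.
have w12 := multiplied_wball
  (multipliedB (wball_cont h1) (wball_cont h2) m1 m2) h12.
have small2 : B * (C * (c * (2 * eps))) <= 2^-1.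
  by apply: (le_trans eps_small2); rewrite lef_pV2 ?posrE // ler_nat.
have := wballC (wball_pseries_lipschitz eps_small1 small2 w1 w2 w12).
move=> /(wball_le (r2 := dl * 2^-1)) h.
apply: wball_eq (h _) => [x|]; first by ring.
rewrite mulrA mulrC; apply: ler_wpM2l => //; by case: h12.
Qed.

Lemma nonlinear_self_map rho u : wball v (2 * eps) rho -> multiplied rho u ->
  wball v (2 * eps) (fun x => q x - pseries_sum a (u x)).
Proof.
move=> h1 m1.
have e20 : 0 <= 2 * eps by rewrite mulr_ge0 // ltW.
(* Compare with the image of 0, which is q. *)
have z : wball v (2 * eps) (fun=> 0) := wball_le e20 (wball0 e20 h1).
have mz : multiplied (fun=> 0) (fun=> 0).
  split; first by case: z.
  have Z (k : 'rV[int]_d) : cos_coef (fun _ : 'rV[R]_d => 0) k = 0 /\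
      sin_coef (fun _ : 'rV[R]_d => 0) k = 0.
    split; rewrite /cos_coef /sin_coef; under eq_fun do rewrite mul0r;
      by rewrite torus_integral_cst mulr0.
  by move=> k; have [-> ->] := Z k; rewrite !mulr0.
have hd : wball v (2 * eps) (fun x => rho x - 0).
  by apply: wball_eq h1 => x; rewrite subr0.
have hz : pseries_sum a 0 = 0.
  rewrite /pseries_sum; apply: cvg_lim => //; apply: cvg_near_cst.
  near=> n; rewrite /pseries /series /= big1 // => -[|i] _; first by rewrite a0 mul0r.
  by rewrite expr0n mulr0.
have := wballD v_gt0 q_ball (nonlinear_contraction h1 z m1 mz hd).
rewrite (_ : eps + _ = 2 * eps); last by field.
by apply: wball_eq => x; rewrite hz; ring.
Unshelve. all: by end_near.
Qed.

Let resolve rho := xget (fun=> 0) [set u | multiplied rho u].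
Let step rho := fun x => q x - pseries_sum a (resolve rho x).

Let resolveP r rho : wball v r rho -> multiplied rho (resolve rho).
Proof.
by move=> /multiplied_exists[u hu]; rewrite /resolve; case: xgetP => // /(_ u).
Qed.

Lemma fixed_point_exists : exists rho u, [/\ wball v (2 * eps) rho,
  multiplied rho u & forall x, rho x = q x - pseries_sum a (u x)].
Proof.
have e20 : 0 <= 2 * eps by rewrite mulr_ge0 // ltW.
(* Picard iteration from 0. *)
pose s n := iter n step (fun=> 0).
have s_ball n : wball v (2 * eps) (s n).
  elim: n => [|n IH] /=; first exact: wball_le e20 (wball0 (ltW eps_gt0) q_ball).
  by apply: nonlinear_self_map (IH) (resolveP IH).
have s_diff n : wball v (2 * eps * 2^-1 ^+ n) (fun x => s n.+1 x - s n x).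
  elim: n => [|n IH].
    rewrite expr0 mulr1; apply: wball_eq (s_ball 1%N) => x.
    by rewrite /s /= subr0.
  rewrite exprSr mulrA.
  exact: nonlinear_contraction (s_ball n.+1) (s_ball n) (resolveP (s_ball n.+1))
    (resolveP (s_ball n)) IH.
have [f sf] := wball_complete v_gt0 v_sum s_diff.
have f_ball : wball v (2 * eps) f := wball_closed s_ball sf.
have f_dist n : wball v (4 * eps * 2^-1 ^+ n) (fun x => f x - s n x).
  apply: (wball_closed (u := fun p x => s (n + p)%N x - s n x)) => [p|e e0].
    suff : wball v (4 * eps * 2^-1 ^+ n * (1 - 2^-1 ^+ p)) (fun x => s (n + p)%N x - s n x).
      apply: wball_le; rewrite ler_piMr // ?gerBl ?exprn_ge0 ?invr_ge0 //.
      by rewrite !mulr_ge0 ?exprn_ge0 ?invr_ge0 // ltW.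
    elim: p => [|p IH].
      rewrite expr0 subrr mulr0; apply: wball_eq (wball0 e20 f_ball) => x.
      by rewrite addn0 subrr.
    have := wballD v_gt0 (s_diff (n + p)%N) IH.
    rewrite (_ : _ + _ = 4 * eps * 2^-1 ^+ n * (1 - 2^-1 ^+ p.+1)); last first.
      by rewrite exprD exprS; field.
    by apply: wball_eq => x; rewrite addnS; ring.
  have [N hN] := sf e e0; exists N => p Np x.
  rewrite opprB addrA subrK; apply: hN; exact: leq_trans Np (leq_addl _ _).
exists f, (resolve f); split=> [//||x]; first exact: resolveP f_ball.
apply/eqP; rewrite -subr_eq0; apply/eqP; move: x.
apply: (@wball_small (4 * eps)) => n.
(* The image of f is close to s n.+1, the image of s n, and so is f. *)
have hstep := nonlinear_contraction f_ball (s_ball n) (resolveP f_ball)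
  (resolveP (s_ball n)) (f_dist n).
have := wballB v_gt0 (f_dist n.+1) hstep.
rewrite (_ : _ + _ = 4 * eps * 2^-1 ^+ n); last by rewrite exprS; field.
by apply: wball_eq => x; rewrite /s /= /step -/(s n); ring.
Qed.

Lemma fixed_point_unique rho1 rho2 u1 u2 :
  wball v (2 * eps) rho1 -> wball v (2 * eps) rho2 ->
  multiplied rho1 u1 -> multiplied rho2 u2 ->
  (forall x, rho1 x = q x - pseries_sum a (u1 x)) ->
  (forall x, rho2 x = q x - pseries_sum a (u2 x)) -> rho1 = rho2.
Proof.
move=> h1 h2 m1 m2 e1 e2; apply/funext => x.
apply/eqP; rewrite -subr_eq0; apply/eqP; move: x.
apply: (@wball_small (2 * eps + 2 * eps)) => n; elim: n => [|n IH].
  by rewrite expr0 mulr1; exact: wballB.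
rewrite exprSr mulrA.
by apply: wball_eq (nonlinear_contraction h1 h2 m1 m2 IH) => x; rewrite -e1 -e2.
Qed.

Lemma multiplied_small rho u x : wball v (2 * eps) rho -> multiplied rho u ->
  (`|u x|%:E < cvg_radius a)%E.
Proof.
move=> h1 m1; apply: (lt_cvg_radius a_bound B_ge0).
apply: le_trans eps_small2; apply: ler_wpM2l => //.
exact: (wball_sup v_gt0 v_sum x (multiplied_wball m1 h1)).
Qed.

End Contraction.

End FixedPoint.

(** * Summability over the lattice *)

Section LatticeSum.
Context (R : realType).

(** A discrete form of the derivative of x^(-q), which bounds the terms of the
    Riemann series of exponent 1 + q by telescoping differences; it rests on
    ln (1 - 1 / (x + 1)) <= - 1 / (x + 1). *)
Lemma powR_telescope (x q : R) : 0 < x -> 0 < q ->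
  q * ((x + 1) `^ (1 + q))^-1 <= (x `^ q)^-1 - ((x + 1) `^ q)^-1.
Proof.
move=> x0 q0; have x1 : 0 < x + 1 by rewrite ltr_wpDl // ltW.
rewrite powRD; last by rewrite (gt_eqF x1) implybT.
rewrite powRr1 ?(ltW x1) //.
have X0 : 0 < x `^ q := powR_gt0 _ x0.
have Y0 : 0 < (x + 1) `^ q := powR_gt0 _ x1.
have ratio : 1 + q / (x + 1) <= (x + 1) `^ q / x `^ q.
  rewrite /powR !gt_eqF // -expRB -mulrBr.
  apply: le_trans (expR_ge1Dx _); rewrite lerD2l; apply: ler_wpM2l; first exact: ltW.
  rewrite -lerN2 opprB -ln_div ?posrE //.
  have -> : x / (x + 1) = 1 + (- (x + 1)^-1) by field; rewrite gt_eqF.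
  apply: le_ln1Dx; rewrite ltrN2 invf_lt1 //; lra.
have -> : (x `^ q)^-1 = ((x + 1) `^ q)^-1 * ((x + 1) `^ q / x `^ q).
  by field; rewrite !gt_eqF.
rewrite -subr_ge0.
have -> : ((x + 1) `^ q)^-1 * ((x + 1) `^ q / x `^ q) - ((x + 1) `^ q)^-1 -
   q * ((x + 1) * (x + 1) `^ q)^-1 =
   ((x + 1) `^ q)^-1 * ((x + 1) `^ q / x `^ q - (1 + q / (x + 1))).
  by field; rewrite !gt_eqF.
by rewrite mulr_ge0 ?subr_ge0 // invr_ge0 ltW.
Qed.

Lemma riemann_sum_le (q : R) (N : nat) : 0 < q ->
  \sum_(m <- iota 0 N) (m.+1%:R `^ (1 + q))^-1 <= 1 + q^-1.
Proof.
move=> q0; case: N => [|N]; first by rewrite big_nil addr_ge0 // invr_ge0 ltW.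
apply: (@le_trans _ _ (1 + q^-1 * (1 - (N.+1%:R `^ q)^-1))); last first.
  by rewrite lerD2l ler_piMr ?invr_ge0 ?(ltW q0) // gerBl invr_ge0 powR_ge0.
elim: N => [|N IH].
  by rewrite big_seq1 powR1 invr1 subrr mulr0 addr0.
rewrite -[N.+2]addn1 iotaD big_cat big_seq1 add0n.
apply: (le_trans (lerD IH (lexx _))).
have := powR_telescope (x := N.+1%:R) (ltr0Sn R N) q0.
rewrite natr1 addn1 -ler_pdivlMl // => h.
rewrite -addrA lerD2l -lerBrDl; apply: (le_trans h).
by rewrite le_eqVlt; apply/orP; left; apply/eqP; ring.
Qed.

(** The maximum with 1 keeps negative powers meaningful at 0 and still lies below
    the Japanese bracket of any frequency having n as a coordinate. *)
Definition coord_size (n : int) : R := (maxn 1 `|n|)%:R.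

Lemma int_sum_le (q : R) : 0 < q ->
  summable_by (fun n : int => (coord_size n `^ (1 + q))^-1) (1 + q^-1 + 1 + (1 + q^-1)).
Proof.
move=> q0 s us.
have [N sN] : exists N, forall n, n \in s -> (`|n| < N)%N.
  exists (\max_(n <- s) `|n|%N).+1 => n ns; rewrite ltnS.
  exact: (@leq_bigmax_seq _ s xpredT (fun n : int => `|n|%N)).
pose t := [seq Posz m | m <- iota 0 N.+1] ++ [seq Negz m | m <- iota 0 N.+1].
apply: (@le_trans _ _ (\sum_(n <- t) (coord_size n `^ (1 + q))^-1)).
  apply: ler_sum_sub => [//||n ns|n]; last by rewrite invr_ge0 powR_ge0.
    have uP : uniq [seq Posz m | m <- iota 0 N.+1].
      by rewrite map_inj_uniq ?iota_uniq // => i j [].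
    have uN : uniq [seq Negz m | m <- iota 0 N.+1].
      by rewrite map_inj_uniq ?iota_uniq // => i j [].
    rewrite cat_uniq uP uN andbT.
    by apply/hasPn => _ /mapP[m _ ->] /=; apply/mapP => -[].
  have nN := sN n ns.
  rewrite mem_cat; case: n nN {ns} => m mN.
    by apply/orP; left; rewrite mem_map ?mem_iota ?(leq_trans mN) //; move=> i j [].
  apply/orP; right; rewrite mem_map; last by move=> i j [].
  by rewrite mem_iota /= add0n (leq_trans (ltnW mN)).
rewrite big_cat !big_map; apply: lerD.
  rewrite /= big_cons /coord_size /= powR1 invr1 addrC lerD2r.
  rewrite (iotaDl 1 0) big_map.
  apply: le_trans (riemann_sum_le N q0); apply: ler_sum => m _.
  by rewrite add1n (maxn_idPr _).
apply: le_trans (riemann_sum_le N.+1 q0); apply: ler_sum => m _.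
by rewrite /coord_size (maxn_idPr _).
Qed.

(** Splitting off the first coordinate embeds any finite set of frequencies in a
    product of a finite set of integers and a finite set in dimension d. *)
Lemma prod_summable d (phi : int -> R) (S : R) : (forall n, 0 <= phi n) ->
  summable_by phi S ->
  summable_by (fun k : 'rV[int]_d => \prod_(i < d) phi (k 0 i)) (S ^+ d).
Proof.
move=> phi0 hS; elim: d => [|d IH] s us.
  apply: (@le_trans _ _ (\sum_(k <- [:: 0 : 'rV[int]_0]) \prod_(i < 0) phi (k 0 i))).
    apply: ler_sum_sub => // [k _|k]; last by rewrite big_ord0.
    by rewrite mem_seq1; apply/eqP/rowP => -[].
  by rewrite big_seq1 big_ord0.
pose hd (k : 'rV[int]_(1 + d)) := k 0 (lshift d 0).
pose tl (k : 'rV[int]_(1 + d)) : 'rV[int]_d := rsubmx k.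
have E (k : 'rV[int]_(1 + d)) :
    \prod_(i < d.+1) phi (k 0 i) = phi (hd k) * \prod_(i < d) phi (tl k 0 i).
  rewrite (@big_split_ord _ _ _ 1 d) big_ord1; congr (_ * _).
  by apply: eq_bigr => i _; rewrite /tl !mxE.
rewrite (eq_bigr _ (fun k _ => E k)).
pose pr (k : 'rV[int]_(1 + d)) := (hd k, tl k).
have pr_inj : injective pr.
  move=> k l [h1 h2]; rewrite -[k]hsubmxK -[l]hsubmxK; congr row_mx => //.
  by apply/rowP => i; rewrite ord1 !mxE.
pose A := undup [seq hd k | k <- s]; pose L := undup [seq tl k | k <- s].
pose F (p : int * 'rV[int]_d) : R := phi p.1 * \prod_(i < d) phi (p.2 0 i).
have P0 (l : 'rV[int]_d) : 0 <= \prod_(i < d) phi (l 0 i) by apply: prodr_ge0.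
apply: (@le_trans _ _ (\sum_(p <- [seq (n, l) | n <- A, l <- L]) F p)).
  rewrite -(big_map pr xpredT F).
  apply: ler_sum_sub => [||p|p].
  - by rewrite map_inj_uniq.
  - by rewrite allpairs_uniq ?undup_uniq // => -[? ?] [? ?] _ _ [-> ->].
  - case/mapP => k ks ->; apply/allpairsP; exists (pr k); split=> //=;
      by rewrite mem_undup; apply/mapP; exists k.
  - by rewrite mulr_ge0.
rewrite big_allpairs /F /= exprS.
under eq_bigr => n _ do rewrite -mulr_sumr.
rewrite -mulr_suml; apply: ler_pM.
- by apply: sumr_ge0 => n _.
- by apply: sumr_ge0 => n _.
- by apply: hS; exact: undup_uniq.
- by apply: IH; exact: undup_uniq.
Qed.

End LatticeSum.

(** * The Gevrey weight *)

Section GevreyWeight.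
Context (R : realType) (d : nat) (t : R).
Implicit Types (k l : 'rV[int]_d).

(** The bracket <k, t k> of which the weight is a function. *)
Definition mode_size k : R := japanese (freq R k) (t *: freq R k).

Let nsq k : R := dotp (freq R k) (freq R k).

Let nsq_ge0 k : 0 <= nsq k.
Proof. by apply: sumr_ge0 => i _; rewrite -expr2 sqr_ge0. Qed.

Lemma mode_size_sqr k : mode_size k ^+ 2 = 1 + (1 + t ^+ 2) * nsq k.
Proof.
have E : dotp (t *: freq R k) (t *: freq R k) = t ^+ 2 * nsq k.
  by rewrite /nsq /dotp mulr_sumr; apply: eq_bigr => i _; rewrite !mxE; ring.
rewrite /mode_size /japanese E sqr_sqrtr -/(nsq k); first by ring.
by rewrite !addr_ge0 // mulr_ge0 // sqr_ge0.
Qed.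

Lemma mode_size_ge0 k : 0 <= mode_size k. Proof. exact: sqrtr_ge0. Qed.

Lemma coord_size_le_mode k i : coord_size R (k 0 i) <= mode_size k.
Proof.
rewrite -ler_sqr ?nnegrE ?mode_size_ge0 ?ler0n // mode_size_sqr.
have ki : (k 0 i)%:~R ^+ 2 <= nsq k.
  rewrite /nsq /dotp (bigD1 i) //= mxE -expr2 lerDl.
  by apply: sumr_ge0 => j _; rewrite -expr2 sqr_ge0.
have ke : nsq k <= (1 + t ^+ 2) * nsq k by rewrite ler_peMl // lerDl sqr_ge0.
rewrite /coord_size; case: (leqP `|k 0 i| 1) => h.
  rewrite expr1n lerDl; exact: le_trans ke.
rewrite natr_absz intr_norm real_normK ?num_real //.
apply: (le_trans ki); apply: (le_trans ke); by rewrite lerDr.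
Qed.

Lemma mode_size_ge1 k : 1 <= mode_size k.
Proof.
rewrite -ler_sqr ?nnegrE ?mode_size_ge0 // mode_size_sqr expr1n lerDl.
by rewrite mulr_ge0 // addr_ge0 // sqr_ge0.
Qed.

(** The bracket is the Euclidean norm of the vector (1, k, t k), so that this is
    a triangle inequality, with Cauchy-Schwarz for the inner product of k and l. *)
Lemma ler_mode_sizeD k l : mode_size (k + l) <= mode_size k + mode_size l.
Proof.
have c0 : 0 <= 1 + t ^+ 2 by rewrite addr_ge0 // sqr_ge0.
rewrite -ler_sqr ?nnegrE ?addr_ge0 ?mode_size_ge0 // sqrrD !mode_size_sqr.
pose p := dotp (freq R k) (freq R l).
have -> : nsq (k + l) = nsq k + 2 * p + nsq l.
  rewrite /nsq /p /dotp mulr_sumr -!big_split; apply: eq_bigr => i _ /=.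
  by rewrite !mxE intrD; ring.
have p2 : p ^+ 2 <= nsq k * nsq l.
  have := @cauchy_schwarz_seq R _ (index_enum 'I_d) (fun=> 1) (freq R k 0) (freq R l 0)
    (fun=> ler01).
  by rewrite /p /nsq /dotp; under eq_bigr do rewrite mul1r;
    under [X in _ <= X * _]eq_bigr do rewrite mul1r expr2;
    under [X in _ <= _ * X]eq_bigr do rewrite mul1r expr2.
have key : (1 + t ^+ 2) * p <= mode_size k * mode_size l.
  have m0 : 0 <= mode_size k * mode_size l by rewrite mulr_ge0 ?mode_size_ge0.
  case: (leP ((1 + t ^+ 2) * p) 0) => h; first exact: le_trans m0.
  rewrite -ler_sqr ?nnegrE ?(ltW h) // !exprMn !mode_size_sqr.
  apply: (@le_trans _ _ (((1 + t ^+ 2) * nsq k) * ((1 + t ^+ 2) * nsq l))).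
    by rewrite [leRHS]mulrACA -[X in X * (nsq k * _)]expr2 ler_wpM2l // sqr_ge0.
  by apply: ler_pM; rewrite ?mulr_ge0 // lerDr.
rewrite -subr_ge0 [leRHS](_ : _ =
  1 + 2 * (mode_size k * mode_size l - (1 + t ^+ 2) * p)); last by ring.
by rewrite addr_ge0 // mulr_ge0 // subr_ge0.
Qed.

End GevreyWeight.

Section GevreyAlgebra.
Context (R : realType) (d : nat) (gamma sigma z t : R).
Hypothesis d_gt0 : (0 < d)%N.
Hypothesis gamma01 : 0 < gamma <= 1.
Hypothesis sigma_gt : d%:R / 2 < sigma.
Hypothesis z_gt0 : 0 < z.
Implicit Types (k l : 'rV[int]_d).

Definition gevrey_weight k : R := weight gamma sigma z (freq R k) (t *: freq R k).

Let gE k := expR (z * mode_size t k `^ gamma).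
Let gP k := mode_size t k `^ sigma.

Let gevrey_weightE k : gevrey_weight k = gE k * gP k. Proof. by []. Qed.

Let sigma_gt0 : 0 < sigma.
Proof. by apply: le_lt_trans sigma_gt; rewrite divr_ge0. Qed.

Let size_gt0 k : 0 < mode_size t k := lt_le_trans ltr01 (mode_size_ge1 t k).

Let gP_gt0 k : 0 < gP k. Proof. exact: powR_gt0. Qed.

Let gE_ge1 k : 1 <= gE k.
Proof. by rewrite -expR0 ler_expR mulr_ge0 ?powR_ge0 // ltW. Qed.

Let gE_gt0 k : 0 < gE k. Proof. exact: expR_gt0. Qed.

Lemma gevrey_weight_gt0 k : 0 < gevrey_weight k ^+ 2.
Proof. by rewrite exprn_gt0 // gevrey_weightE mulr_gt0. Qed.

Lemma submultiplicative_bound (ek el em pk pl pm c : R) : 0 < ek -> 0 < el ->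
  0 < em -> 0 < pl -> 0 < pm -> ek <= el * em ->
  pk ^+ 2 <= c * (pl ^+ 2 + pm ^+ 2) ->
  (ek * pk) ^+ 2 / ((el * pl) ^+ 2 * (em * pm) ^+ 2) <=
  c * ((pl ^+ 2)^-1 + (pm ^+ 2)^-1).
Proof.
move=> ek0 el0 em0 pl0 pm0 he hp.
rewrite ler_pdivrMr ?mulr_gt0 ?exprn_gt0 ?mulr_gt0 //.
have -> : c * ((pl ^+ 2)^-1 + (pm ^+ 2)^-1) * ((el * pl) ^+ 2 * (em * pm) ^+ 2) =
    (el * em) ^+ 2 * (c * (pl ^+ 2 + pm ^+ 2)).
  by field; rewrite !gt_eqF.
rewrite exprMn; apply: ler_pM; rewrite ?sqr_ge0 //.
by rewrite lerXn2r ?nnegrE ?mulr_ge0 // ltW.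
Qed.

(** With s = x + y, each u <= s satisfies (u / s) <= (u / s)^p because p <= 1;
    add these for u = x and u = y. *)
Lemma ler_powRD (x y p : R) : 0 < x -> 0 < y -> p <= 1 ->
  (x + y) `^ p <= x `^ p + y `^ p.
Proof.
move=> x0 y0 p1; have s0 : 0 < x + y by rewrite addr_gt0.
have H u : 0 < u -> u <= x + y -> u / (x + y) * (x + y) `^ p <= u `^ p.
  move=> u0 us; rewrite -[in leRHS](divfK (lt0r_neq0 s0) u).
  rewrite powRM ?divr_ge0 ?(ltW u0) ?(ltW s0) //.
  apply: ler_wpM2r; first exact: powR_ge0.
  by apply: ger1_powR => //; rewrite divr_gt0 //= ler_pdivrMr // mul1r.
have hx := H x x0; have hy := H y y0.
rewrite -[leLHS]mul1r -[X in X * _](mulfV (lt0r_neq0 s0)) !mulrDl.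
by apply: lerD; [apply: hx; rewrite lerDl ltW|apply: hy; rewrite lerDr ltW].
Qed.

Let gE_sub k l : gE k <= gE l * gE (k - l).
Proof.
rewrite -expRD ler_expR -mulrDr; apply: ler_wpM2l; first exact: ltW.
have /andP[g0 g1] := gamma01.
apply: le_trans (ler_powRD (size_gt0 l) (size_gt0 (k - l)) g1).
apply: ge0_ler_powR; rewrite ?nnegrE ?addr_ge0 ?mode_size_ge0 ?(ltW g0) //.
by have := ler_mode_sizeD t l (k - l); rewrite addrC subrK.
Qed.

(* The larger of the two brackets is at least half of that of k. *)
Let gP_sub k l : gP k ^+ 2 <=
  (2 `^ sigma) ^+ 2 * (gP l ^+ 2 + gP (k - l) ^+ 2).
Proof.
have D : mode_size t k <= mode_size t l + mode_size t (k - l).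
  by have := ler_mode_sizeD t l (k - l); rewrite addrC subrK.
have H m : mode_size t k <= 2 * mode_size t m ->
    gP k ^+ 2 <= (2 `^ sigma) ^+ 2 * gP m ^+ 2.
  move=> km; rewrite -exprMn lerXn2r ?nnegrE ?mulr_ge0 ?powR_ge0 //.
  rewrite /gP -powRM ?mode_size_ge0 //.
  by apply: ge0_ler_powR; rewrite ?nnegrE ?mulr_ge0 ?mode_size_ge0 // ltW.
have q0 m : 0 <= (2 `^ sigma) ^+ 2 * gP m ^+ 2 by rewrite mulr_ge0 ?sqr_ge0.
rewrite mulrDr; case: (leP (mode_size t l) (mode_size t (k - l))) => h.
  by rewrite -[leLHS]add0r; apply: lerD => //; apply: H; lra.
by rewrite -[leLHS]addr0; apply: lerD => //; apply: H; lra.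
Qed.

Definition lattice_const : R :=
  let q := 2 * sigma / d%:R - 1 in (1 + q^-1 + 1 + (1 + q^-1)) ^+ d.

(* The bracket dominates every coordinate, so its power 2 sigma dominates the
   product of the powers 2 sigma / d > 1 of the coordinates. *)
Let gP_summable : summable_by (fun k => (gP k ^+ 2)^-1) lattice_const.
Proof.
have dR : 0 < d%:R :> R by rewrite ltr0n.
pose q := 2 * sigma / d%:R - 1.
have q0 : 0 < q.
  by rewrite subr_gt0 ltr_pdivlMr // mul1r -ltr_pdivrMl // mulrC.
move=> s us.
have h := @prod_summable R d _ _ (fun n => _) (int_sum_le q0) s us.
apply: le_trans (h _); last by move=> n; rewrite invr_ge0 powR_ge0.
apply: ler_sum => k _.
rewrite /= prodfV lef_pV2 ?posrE ?exprn_gt0 //; last first.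
  by apply: prodr_gt0 => i _; rewrite powR_gt0 // ltr0n leq_max.
have -> : gP k ^+ 2 = \prod_(i < d) mode_size t k `^ (1 + q).
  rewrite prodr_const card_ord -(powR_mulrn 2 (powR_ge0 _ _)).
  rewrite -(powR_mulrn d (powR_ge0 _ _)) -!powRrM.
  by congr powR; rewrite /q; field; rewrite gt_eqF.
apply: ler_prod => i _; rewrite powR_ge0 /=.
apply: ge0_ler_powR; rewrite ?nnegrE ?mode_size_ge0 ?ler0n ?coord_size_le_mode //.
by rewrite addr_ge0 // ltW.
Qed.

Lemma gevrey_weight_summable :
  summable_by (fun k => (gevrey_weight k ^+ 2)^-1) lattice_const.
Proof.
move=> s us; apply: le_trans (gP_summable us); apply: ler_sum => k _.
rewrite lef_pV2 ?posrE ?gevrey_weight_gt0 ?exprn_gt0 //.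
rewrite gevrey_weightE exprMn ler_peMl ?sqr_ge0 //.
by rewrite exprn_ege1.
Qed.

(** The exponential factor is submultiplicative because gamma <= 1, so it
    disappears; of the polynomial factors at least one of the two in the
    denominator is comparable to the numerator, and the other is summable. *)
Lemma gevrey_weight_convolution k : summable_by
  (fun l => gevrey_weight k ^+ 2 /
            (gevrey_weight l ^+ 2 * gevrey_weight (k - l) ^+ 2))
  ((2 `^ sigma) ^+ 2 * (lattice_const + lattice_const)).
Proof.
move=> s us.
have pointwise l : gevrey_weight k ^+ 2 /
      (gevrey_weight l ^+ 2 * gevrey_weight (k - l) ^+ 2) <=
    (2 `^ sigma) ^+ 2 * ((gP l ^+ 2)^-1 + (gP (k - l) ^+ 2)^-1).
  rewrite !gevrey_weightE.
  exact: (submultiplicative_bound (gE_gt0 k) (gE_gt0 l) (gE_gt0 (k - l))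
    (gP_gt0 l) (gP_gt0 (k - l)) (gE_sub k l) (gP_sub k l)).
apply: (le_trans (ler_sum _ (fun l _ => pointwise l))).
rewrite -mulr_sumr; apply: ler_wpM2l; first exact: sqr_ge0.
rewrite big_split /=; apply: lerD; first exact: gP_summable.
have := gP_summable (s := [seq k - l | l <- s]); rewrite big_map; apply.
by rewrite map_inj_uniq // => l m /addrI /oppr_inj.
Qed.


End GevreyAlgebra.

(** * From the weighted space to the Gevrey balls *)

Section Translation.
Context (R : realType) (d : nat).

Lemma esum_le_summable (I : countType) (b : I -> R) (B : R) : (forall i, 0 <= b i) ->
  (\esum_(i in [set: I]) (b i)%:E <= B%:E)%E <-> summable_by b B.
Proof.
move=> b0; split=> [h s us|h].
  rewrite -lee_fin; apply: le_trans h; apply: ereal_sup_ubound.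
  exists [set` s]; first by split; [exact: finite_seq|exact: subsetT].
  by rewrite -fsbig_seq // sumEFin.
apply: ge_ereal_sup => _ [A [finA _] <-].
by rewrite fsbig_finite // sumEFin lee_fin; apply: h; exact: finmap.fset_uniq.
Qed.

Lemma gevrey_ballP (gamma sigma z t r : R) (f : 'rV[R]_d -> R) :
  gevrey_ball gamma sigma z t r f <->
  wball (fun k => gevrey_weight gamma sigma z t k ^+ 2) r f.
Proof.
have normE k : Normc.normc (fourier f k) ^+ 2 = amp f k ^+ 2.
  by rewrite fourier_coefs /= sqrrN.
pose S := (\esum_(k in [set: 'rV[int]_d])
  (gevrey_weight gamma sigma z t k ^+ 2 * amp f k ^+ 2)%:E)%E.
have SE : gevrey_norm gamma sigma z t f = (S `^ 2^-1)%E.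
  rewrite /gevrey_norm /S; congr poweR.
  by congr esum; apply/funext => k; rewrite normE.
have b0 (k : 'rV[int]_d) : 0 <= gevrey_weight gamma sigma z t k ^+ 2 * amp f k ^+ 2.
  by rewrite mulr_ge0 ?sqr_ge0.
have S0 : (0 <= S)%E by apply: esum_ge0 => k _; rewrite lee_fin.
have sqrtP (y : \bar R) : (0 <= y)%E -> 0 <= r ->
    (y `^ 2^-1 <= r%:E)%E <-> (y <= (r ^+ 2)%:E)%E.
  move=> + r0; case: y => [x|_|//].
  - rewrite !lee_fin => x0; rewrite powR12_sqrt //.
    split=> h; first by rewrite -[x]sqr_sqrtr // lerXn2r ?nnegrE ?sqrtr_ge0.
    by rewrite -[r]ger0_norm // -sqrtr_sqr ler_wsqrtr.
  - by rewrite poweRyr ?invr_eq0 ?pnatr_eq0 // !leye_eq.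
split=> [[tf]|[tf r0 hf]].
  rewrite SE => h; have r0 : 0 <= r by rewrite -lee_fin (le_trans _ h) // poweR_ge0.
  by split=> //; apply/(esum_le_summable _ b0); apply/(sqrtP _ S0 r0).
by split=> //; rewrite SE; apply/(sqrtP _ S0 r0)/(esum_le_summable _ b0).
Qed.

Definition resolvent_symbol (beta : R) (k : 'rV[int]_d) : R :=
  (beta + dotp (freq R k) (freq R k))^-1.

Lemma is_resolventP (beta : R) (rho u : 'rV[R]_d -> R) :
  is_resolvent beta rho u <-> multiplied (resolvent_symbol beta) rho u.
Proof.
have E k : fourier u k = ((resolvent_symbol beta k)%:C * fourier rho k)%C <->
    cos_coef u k = resolvent_symbol beta k * cos_coef rho k /\
    sin_coef u k = resolvent_symbol beta k * sin_coef rho k.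
  rewrite !fourier_coefs; split=> [[-> h]|[-> ->]].
    rewrite mul0r subr0; split=> //.
    by move: h; rewrite mul0r addr0 mulrN => /oppr_inj.
  by congr Complex; rewrite !mul0r ?subr0 ?addr0 ?mulrN.
by split=> -[tu h]; split=> // k; apply/E; apply: h.
Qed.

Lemma resolvent_symbolN beta k : resolvent_symbol beta (- k) = resolvent_symbol beta k.
Proof.
congr (_ + _)^-1; apply: eq_bigr => i _.
by rewrite !mxE intrN mulrNN.
Qed.

(** A nonzero frequency has |k|^2 >= 1; the frequency 0 contributes beta^-1,
    including when beta = 0, as 0^-1 = 0. *)
Lemma resolvent_symbol_bound beta k : 0 <= beta ->
  `|resolvent_symbol beta k| <= 1 + beta^-1.
Proof.
move=> beta0; rewrite /resolvent_symbol; set n := dotp _ _.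
have n0 : 0 <= n by apply: sumr_ge0 => i _; rewrite -expr2 sqr_ge0.
rewrite ger0_norm; last by rewrite invr_ge0 addr_ge0.
have [k00|kn0] := eqVneq k 0.
  rewrite (_ : n = 0) ?addr0 ?lerDr //.
  by rewrite /n k00 /dotp big1 // => i _; rewrite !mxE mul0r.
have [i ki] : exists i, k 0 i != 0.
  apply/existsP; apply: contraT; rewrite negb_exists => /forallP h.
  by case/eqP: kn0; apply/rowP => i; rewrite mxE; apply/eqP; rewrite -[_ == _]negbK h.
have n1 : 1 <= n.
  rewrite /n /dotp (bigD1 i) //= mxE; apply: ler_wpDr.
    by apply: sumr_ge0 => j _; rewrite -expr2 sqr_ge0.
  have h1 : 1 <= `|(k 0 i)%:~R| :> R.
    by rewrite -intr_norm ler1z -gtz0_ge1 normr_gt0.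
  by rewrite -expr2 -(real_normK (num_real _)) exprn_ege1.
apply: (@le_trans _ _ 1); last by rewrite lerDl invr_ge0.
by rewrite invf_le1 ?(lt_le_trans ltr01) // (le_trans n1) // lerDr.
Qed.

End Translation.

(** * The fixed point theorem *)

Theorem proposition4p2 (R : realType) (d : nat) (beta gamma sigma z t : R)
    (a : R^nat)
    (hd : (1 <= d)%N) (hbeta : 0 <= beta)
    (hgamma : 3^-1 < gamma /\ gamma <= 1)
    (hsigma : d%:R / 2 < sigma) (hz : 0 < z)
    (ha0 : a 0%N = 0) (ha1 : a 1%N = 0)
    (hradius : (0 < cvg_radius a)%E) :
  exists r : R -> R,
    (r =O_ (0^'+) (fun eps : R => eps)) /\
    \forall eps \near 0^'+,
      forall q : 'rV[R]_d -> R, gevrey_ball gamma sigma z t eps q ->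
        exists! rho : 'rV[R]_d -> R,
          gevrey_ball gamma sigma z t (r eps) rho /\ is_solution beta a q rho.
Proof.
have [M [B [B0 aB]]] := cvg_radius_bound hradius.
have g01 : 0 < gamma <= 1.
  by case: hgamma => g1 ->; rewrite andbT (lt_trans _ g1) // invr_gt0.
pose v (k : 'rV[int]_d) := gevrey_weight gamma sigma z t k ^+ 2.
have v0 k : 0 < v k by exact: gevrey_weight_gt0.
have vK := gevrey_weight_summable gamma t hd hsigma hz.
have vW := gevrey_weight_convolution t hd g01 hsigma hz.
set K := lattice_const _ _ in vK vW.
set W := (_ ^+ 2 * _) in vW.
pose m := @resolvent_symbol R d beta.
pose c : R := 1 + beta^-1.
have mN k : m (- k) = m k by exact: resolvent_symbolN.
have mc k : `|m k| <= c by exact: resolvent_symbol_bound.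
have c0 : 0 <= c by exact: le_trans (normr_ge0 _) (mc 0).
have M0 : 0 <= M by have := aB 0%N; rewrite expr0 mulr1; exact: le_trans.
have k0 : 0 <= mul_const d W := mul_const_ge0 d W.
have C0 : 0 <= sup_const d K := sup_const_ge0 d K.
(* The three smallness conditions on eps read eps * Di <= 1. *)
pose D1 := 8 * (B * mul_const d W * c).
pose D2 := 8 * (B * sup_const d K * c).
pose D3 := 32 * (M * B ^+ 2 * mul_const d W * c * c).
have D10 : 0 <= D1 by rewrite /D1; do 3!apply: mulr_ge0 => //.
have D20 : 0 <= D2 by rewrite /D2; do 3!apply: mulr_ge0 => //.
have D30 : 0 <= D3.
  rewrite /D3; apply: mulr_ge0 => //; do 4!apply: mulr_ge0 => //; exact: sqr_ge0.
exists (fun eps => 2 * eps); split.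
  apply/eqOP; exists 2; split=> // C hC; apply: nearW => x.
  by rewrite normrM ger0_norm //; apply: ler_wpM2r => //; exact: ltW.
have D0 : 0 < (D1 + D2 + D3 + 1)^-1.
  by rewrite invr_gt0 ltr_wpDl // !addr_ge0.
near=> eps => q /gevrey_ballP hq.
have e0 : 0 < eps by near: eps; exact: nbhs_right_gt.
have eD : eps * (D1 + D2 + D3 + 1) <= 1.
  rewrite -ler_pdivlMr; last by rewrite -invr_gt0.
  by rewrite mul1r ltW //; near: eps; exact: nbhs_right_lt.
rewrite !mulrDr mulr1 in eD.
have p1 : 0 <= eps * D1 by rewrite mulr_ge0 // ltW.
have p2 : 0 <= eps * D2 by rewrite mulr_ge0 // ltW.
have p3 : 0 <= eps * D3 by rewrite mulr_ge0 // ltW.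
have s1 : 4 * B * mul_const d W * (c * (2 * eps)) <= 1.
  rewrite (_ : _ * (c * _) = eps * D1); first by lra.
  by rewrite /D1; ring.
have s2 : B * (sup_const d K * (c * (2 * eps))) <= 4^-1.
  rewrite (_ : B * _ = eps * D2 * 4^-1); first by lra.
  by rewrite /D2; field.
have s3 : 8 * M * B ^+ 2 * mul_const d W * (c * (2 * eps)) * c <= 2^-1.
  rewrite (_ : _ * c = eps * D3 * 2^-1); first by lra.
  by rewrite /D3; field.
have [rho [u [hr hu eq]]] :=
  fixed_point_exists v0 vK vW aB B0 ha0 ha1 mN mc e0 s1 s2 s3 hq.
exists rho; split.
  split; first exact/gevrey_ballP.
  exists u; split; first exact/is_resolventP.
  move=> x; split; last exact: eq.
  exact: (multiplied_small v0 vK aB B0 mN mc s2 x hr hu).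
move=> rho' [/gevrey_ballP hr' [u' [/is_resolventP hu' eq']]].
apply: (fixed_point_unique v0 vK vW aB B0 ha0 ha1 mN mc s1 s2 s3 hr hr' hu hu' eq).
by move=> x; case: (eq' x).
Unshelve. all: by end_near.
Qed.
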